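(* Let $M$ be a complete connected Riemannian manifold of dimension $d\ge 2$, and suppose a group $G$ acts geometrically on $M$ and is of polynomial growth of order $\alpha>0$. Then for every $x_0\in M$ there exist constants $C>0$ and $R_0>0$ such that for all $R\ge R_0$ and all $N\in\mathbb{N}$ with $N\ge 1$, $$N\, r_N(\partial B_R(x_0))^{d-1}\le C R^{\alpha+d-1}.$$ Thus $M$ has $O(R^{\frac{\alpha}{d-1}+1})$ covering growth around any point $x_0\in M$: for every $x_0\in M$ there exist $C'>0$ and $R_0>0$ such that $k\,r_{k^{d-1}}(\partial B_R(x_0))\le C' R^{\frac{\alpha}{d-1}+1}$ for all $k\in\mathbb{N}$, $k\ge1$, and all $R\ge R_0$.
   Context: $B_r(x)$ is the open ball for the Riemannian distance and $\partial B_R(x_0)$ is the boundary of $B_R(x_0)$. For $A\subseteq M$ compact and $N\ge1$, the covering radius $r_N(A)$ is the infimum of all $r>0$ such that $A$ can be covered by $N$ open balls of radius $r$ with centers in $M$. A group action of $G$ on a locally compact metric space $X$ is geometric if: each $\gamma\in G$ acts by an isometry; for each compact $K\subseteq X$ the set $\{\gamma\in G : \gamma\cdot K\cap K\neq\varnothing\}$ is finite; and there is a compact $K\subseteq X$ with $\bigcup_{\gamma\in G}\gamma\cdot K=X$. Let $G$ be finitely generated with finite generating set $\mathcal{A}$. The word length $|\gamma|_{\mathcal{A}}$ is the length of the shortest representation of $\gamma$ as a product of elements of $\mathcal{A}\cup\mathcal{A}^{-1}$ (with $|e|_{\mathcal{A}}=0$), and the growth function is $\beta_{\mathcal{A}}(k)=\#\{\gamma\in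 G : |\gamma|_{\mathcal{A}}\le k\}$. $G$ is of polynomial growth of order $\alpha$ if there exist $C,k_0>0$ with $\beta_{\mathcal{A}}(k)\le Ck^\alpha$ for all $k\ge k_0$ (this does not depend on the choice of $\mathcal{A}$). *)

(* Defs.v *)
From HB Require Import structures.
From mathcomp Require Import all_boot all_order all_algebra finmap.
From mathcomp Require Import all_classical all_reals all_analysis.

Set Implicit Arguments.
Unset Strict Implicit.
Unset Printing Implicit Defensive.

Import Order.TTheory GRing.Theory Num.Theory.
Import numFieldNormedType.Exports.

Local Open Scope classical_set_scope.
Local Open Scope ring_scope.

(* [C^k] maps on an open set [U]; on open sets, iterating directional
   derivatives is the same as iterating partial derivatives. *)
Fixpoint Ck_on (R : realType) (V W : normedModType R) (k : nat) (U : set V)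
    (f : V -> W) : Prop :=
  match k with
  | 0 => forall x, U x -> {for x, continuous f}
  | k'.+1 => (forall x, U x -> differentiable f x) /\
             (forall v, Ck_on k' U ('D_v f))
  end.

Definition smooth_on (R : realType) (V W : normedModType R) (U : set V)
    (f : V -> W) : Prop :=
  forall k, Ck_on k U f.

Record chart (R : realType) (d : nat) (M : topologicalType) := Chart {
  chart_dom : set M;
  chart_cod : set 'rV[R]_d;
  chart_fun : M -> 'rV[R]_d;
  chart_inv : 'rV[R]_d -> M;
  chart_dom_open : open chart_dom;
  chart_cod_open : open chart_cod;
  chart_fun_cod : forall p, chart_dom p -> chart_cod (chart_fun p);
  chart_inv_dom : forall x, chart_cod x -> chart_dom (chart_inv x);
  chart_funK : forall p, chart_dom p -> chart_inv (chart_fun p) = p;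
  chart_invK : forall x, chart_cod x -> chart_fun (chart_inv x) = x;
  chart_fun_continuous : {within chart_dom, continuous chart_fun};
  chart_inv_continuous : {within chart_cod, continuous chart_inv} }.

Definition transition (R : realType) (d : nat) (M : topologicalType)
    (a b : chart R d M) : 'rV[R]_d -> 'rV[R]_d :=
  chart_fun b \o chart_inv a.

Definition transition_dom (R : realType) (d : nat) (M : topologicalType)
    (a b : chart R d M) : set 'rV[R]_d :=
  chart_fun a @` (chart_dom a `&` chart_dom b).

Record smooth_manifold (R : realType) (d : nat) (M : topologicalType) :=
  SmoothManifold {
    chart_index : Type;
    atlas : chart_index -> chart R d M;
    atlas_cover : forall p, exists i, chart_dom (atlas i) p;
    atlas_smooth : forall i j,
      smooth_on (transition_dom (atlas i) (atlas j))
                (transition (atlas i) (atlas j));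
    manifold_hausdorff : hausdorff_space M;
    manifold_second_countable : @second_countable M }.

(* A Riemannian metric is given by its Gram matrix [metric_mx i x] in each
   chart [i], at the point of coordinates [x].  Tangent vectors are row vectors,
   so that [u] and [v] have inner product [u *m metric_mx i x *m v^T], and the
   differential of [f] at [x] is [fun u => u *m 'J f x]. *)
Record riemannian_metric (R : realType) (d : nat) (M : topologicalType)
    (S : smooth_manifold R d M) := RiemannianMetric {
  metric_mx : chart_index S -> 'rV[R]_d -> 'M[R]_d;
  metric_smooth : forall i, smooth_on (chart_cod (atlas i)) (metric_mx i);
  metric_sym : forall i x, chart_cod (atlas i) x ->
    (metric_mx i x)^T = metric_mx i x;
  metric_posdef : forall i x (u : 'rV[R]_d), chart_cod (atlas i) x ->
    u != 0 -> 0 < (u *m metric_mx i x *m u^T) 0 0;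
  metric_compat : forall i j x, transition_dom (atlas i) (atlas j) x ->
    let tau := transition (atlas i) (atlas j) in
    metric_mx i x = 'J tau x *m metric_mx j (tau x) *m ('J tau x)^T }.

Section RiemannianDistance.
Context {R : realType} {d : nat} {M : topologicalType}.
Context {S : smooth_manifold R d M}.

Definition coord_curve (i : chart_index S) (c : R -> M) : R -> 'rV[R]_d :=
  chart_fun (atlas i) \o c.

(* [c] is C^1 in a neighbourhood of each point of [0, 1], that is, its
   restriction to [0, 1] is C^1 up to the endpoints.  The values of [c] far from
   [0, 1] are irrelevant. *)
Definition C1_curve (c : R -> M) : Prop :=
  forall t : R, t \in `[0, 1] ->
    {for t, continuous c} /\
    forall i, chart_dom (atlas i) (c t) ->
      (\forall s \near t, derivable (coord_curve i c) s 1) /\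
      {for t, continuous (derive1 (coord_curve i c))}.

Definition chart_at (p : M) : chart_index S :=
  projT1 (cid (atlas_cover S p)).

Variable g : riemannian_metric S.

(* By [metric_compat], the speed does not depend on the chart around [c t]. *)
Definition speed (c : R -> M) (t : R) : R :=
  let i := chart_at (c t) in
  let v := derive1 (coord_curve i c) t in
  Num.sqrt ((v *m metric_mx g i (coord_curve i c t) *m v^T) 0 0).

Definition curve_length (c : R -> M) : R :=
  \int[lebesgue_measure]_(t in `[0, 1]) speed c t.

(* [piecewise_C1_path p q l]: some concatenation of finitely many C^1 curves,
   of total length [l], leads from [p] to [q]. *)
Inductive piecewise_C1_path : M -> M -> R -> Prop :=
| path_nil p : piecewise_C1_path p p 0
| path_cons c q l : C1_curve c -> piecewise_C1_path (c 1) q l ->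
    piecewise_C1_path (c 0) q (curve_length c + l).

(* On a connected manifold, the set of lengths is never empty. *)
Definition riemannian_dist (p q : M) : R :=
  inf [set l | piecewise_C1_path p q l].

End RiemannianDistance.

Definition complete_space (M : uniformType) : Prop :=
  forall F : set_system M, ProperFilter F -> cauchy F -> exists x : M, F --> x.

Section MetricSpaces.
Context {R : realType} {X : metricType R}.

Definition boundary (A : set X) : set X := closure A `\` interior A.

(* [ball x r] is the open ball [[set y | mdist x y < r]], see [ballEmdist]. *)
Definition covering_radius (N : nat) (A : set X) : R :=
  inf [set r : R | 0 < r /\
    exists x : 'I_N -> X, A `<=` \bigcup_(i in [set: 'I_N]) ball (x i) r].

Record geometric_action (G : groupType) (act : G -> X -> X) : Prop :=
  GeometricAction {
    act_one : forall x, act 1%g x = x;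
    act_mul : forall a b x, act (a * b)%g x = act a (act b x);
    act_isometry : forall a x y, mdist (act a x) (act a y) = mdist x y;
    act_proper : forall K : set X, compact K ->
      finite_set [set a | (act a @` K) `&` K !=set0];
    act_cocompact : exists2 K : set X, compact K &
      \bigcup_(a in [set: G]) (act a @` K) = [set: X] }.

End MetricSpaces.

Section Growth.
Context {G : groupType}.

Definition word_of_length (A : set G) (n : nat) (a : G) : Prop :=
  exists s : seq G, [/\ size s = n,
    forall b, b \in s -> A b \/ A (b^-1)%g & a = (\prod_(b <- s) b)%g].

Definition generating_set (A : set G) : Prop :=
  forall a, exists n, word_of_length A n a.

(* Takes the dummy value 0 outside the subgroup generated by [A]. *)
Definition word_length (A : set G) (a : G) : nat :=
  if pselect (exists n, `[< word_of_length A n a >]) is left ex_n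
  then ex_minn ex_n else 0%N.

(* [fset_set] is meaningful on finite sets only; the word balls are finite when
   [A] is finite and generating. *)
Definition growth_function (A : set G) (k : nat) : nat :=
  #|` fset_set [set a | (word_length A a <= k)%N] |.

End Growth.

Definition polynomial_growth (R : realType) (G : groupType) (alpha : R) : Prop :=
  exists A : set G, [/\ finite_set A, generating_set A &
    exists C k0 : R, [/\ 0 < C, 0 < k0 & forall k : nat, k0 <= k%:R ->
      (growth_function A k)%:R <= C * k%:R `^ alpha]].

(* Main.v *)
Require Import Defs.
From HB Require Import structures.
From mathcomp Require Import all_boot all_order all_algebra finmap.
From mathcomp Require Import all_classical all_reals all_analysis.
From mathcomp Require Import ring lra.

Set Implicit Arguments.
Unset Strict Implicit.
Unset Printing Implicit Defensive.

Import Order.TTheory GRing.Theory Num.Theory.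
Import numFieldNormedType.Exports.

Local Open Scope classical_set_scope.
Local Open Scope ring_scope.

(** The proof covers a large sphere by balls of radius e, with e at most 1, and
   shows that O(R ^ alpha / e ^ (d - 1)) balls are enough; the bound on the
   covering radius follows by choosing e in terms of N. Two facts are combined.

   The first one is coarse ([orbit_count]). Let K be a compact set whose
   translates cover M. Walking from a translate of K back to x0 by short steps,
   one passes through translates whose group elements change at each step by a
   factor from a finite set, so a translate that meets the ball of radius R has
   word length O(R). Polynomial growth leaves O(R ^ alpha) such translates.

   The second one is local and uniform ([sphere_compact_cover]): for every centre
   o and every radius t at least 1, the part in K of the sphere of centre o and
   radius t is covered by O(e ^ (- (d - 1))) balls of radius e. Since the action
   is by isometries, the part of the sphere around x0 in a translate of K is
   isometric to the part in K of a sphere around another centre, so the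
   uniformity in o is exactly what is needed ([sphere_cover]).

   The local fact holds because spheres are locally Lipschitz graphs. Let f be
   the distance to o. In coordinates around a point p of the sphere, f has a
   superdifferential at p with a uniform error ([superdifferential]):
     f (p + y) <= f p - l y + kappa |y| + eta,
   where the linear form l is bounded above and away from 0, kappa is as small as
   one likes and eta is arbitrarily small. This is the first variation formula: an
   almost minimizing chain of short steps from p towards o, of total length
   delta, is displaced so that it starts at p + y and ends at the same point,
   and the change of its length is estimated step by step. If p + y is on the
   same sphere, then l y <= kappa |y| + eta; exchanging the two points bounds
   - l y as well, provided their forms are close. Hence l y is small compared to
   |y|, and one coordinate of y, for which the coefficient of l is large, is
   controlled by the d - 1 other ones. Cutting these coordinates into cells of
   size proportional to e gives the cover ([sphere_local_cover]).

   The estimate of one step needs the square of the distance to third order: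
     mdist (P x) (P y) ^ 2 = Q_x (y - x) + O(|y - x| ^ 3)
   in coordinates, where Q_x is the Gram matrix ([exists_local_model]). Segments
   give the upper bound. The lower bound is a calibration ([calibration]): a
   linear form that is dominated by the metric cannot increase along a path by
   more than its length. Minimizing geodesics are never needed: the definition
   of the distance as an infimum of lengths provides chains that are minimizing
   up to an arbitrarily small error ([walk_towards]). *)

(** * Primitives on the unit interval *)

Section RealCalculus.
Context {R : realType}.
Implicit Types (f F : R -> R) (t : R).

Lemma in01P t : t \in `[0, 1] <-> 0 <= t <= 1.
Proof. by rewrite in_itv. Qed.

(** The retraction of the line onto [0, 1]: composing with it turns a function
   that is continuous at the points of [0, 1] into one that is continuous
   everywhere, so that no one-sided condition is needed at the endpoints. *)
Definition clamp01 t : R := Num.max 0 (Num.min 1 t).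

Lemma clamp01_in t : clamp01 t \in `[0, 1].
Proof.
apply/in01P; rewrite /clamp01 le_max lexx /= ge_max ler01 /=.
by rewrite ge_min lexx.
Qed.

Lemma clamp01_id t : t \in `[0, 1] -> clamp01 t = t.
Proof.
by move=> /in01P/andP[t0 t1]; rewrite /clamp01 min_r// max_r.
Qed.

Lemma clamp01_continuous : continuous clamp01.
Proof.
move=> t; rewrite /clamp01.
apply: (@continuous_max _ _ (cst 0) (fun t => Num.min 1 t)).
  exact: cvg_cst.
apply: (@continuous_min _ _ (cst 1) id) => //.
exact: cvg_cst.
Qed.

Lemma FTC2_01 f F :
  (forall t, t \in `[0, 1] -> {for t, continuous f}) ->
  (forall t, t \in `[0, 1] -> is_derive t 1 F (f t)) ->
  \int[lebesgue_measure]_(t in `[0, 1]) f t = F 1 - F 0.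
Proof.
move=> fc Fd.
have Fc t : t \in `[0, 1] -> {for t, continuous F}.
  move=> /Fd ft; apply: differentiable_continuous; apply/derivable1_diffP.
  exact: ex_derive.
have oc t : t \in `]0, 1[ -> t \in `[0, 1] :> Prop.
  by rewrite !in_itv/= => /andP[/ltW-> /ltW->].
have e0 : (0 : R) \in `[0, 1] by apply/in01P; rewrite lexx ler01.
have e1 : (1 : R) \in `[0, 1] by apply/in01P; rewrite lexx ler01.
rewrite /Rintegral (@continuous_FTC2 _ f F)//.
- apply: continuous_in_subspaceT => t; rewrite inE/= => t01.
  exact: fc.
- split.
  + by move=> t /oc /Fd ft; exact: ex_derive.
  + by apply: cvg_at_right_filter; exact: Fc.
  + by apply: cvg_at_left_filter; exact: Fc.
- move=> t /oc /Fd ft; rewrite derive1E; exact: derive_val.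
Qed.

Lemma primitive_01 f :
  (forall t, t \in `[0, 1] -> {for t, continuous f}) ->
  exists F, forall t, t \in `[0, 1] -> is_derive t 1 F (f t).
Proof.
move=> fc.
pose h := f \o clamp01.
have hc : continuous h.
  move=> t; apply: continuous_comp; first exact: clamp01_continuous.
  by apply: fc; exact: clamp01_in.
(* integrating from -1 makes 0 an interior point of the domain *)
exists (fun x => \int[lebesgue_measure]_(t in `[(-1), x]) h t) => t t01.
have [t0 t1] : 0 <= t /\ t <= 1 by move/in01P : (t01) => /andP.
have [|||dF F'] := @continuous_FTC1_closed R h (-1) t 2 _ _ _ (hc t).
- by lra.
- apply: continuous_compact_integrable; first exact: segment_compact.
  exact: continuous_subspaceT.
- by lra.
apply: DeriveDef => //.
by rewrite -derive1E F' /h /= clamp01_id.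
Qed.

End RealCalculus.

(** * The speed of a curve and its arc length *)

Section Bform.
Context {R : realType} {d : nat}.

Definition bform (Q : 'M[R]_d) (u v : 'rV[R]_d) : R :=
  (u *m Q *m v^T) 0 0.

Lemma bformE Q u v : bform Q u v = \sum_i (\sum_j u 0 j * Q j i) * v 0 i.
Proof. by rewrite /bform mxE; apply: eq_bigr => i _; rewrite !mxE. Qed.

Lemma cvg_bform (T : Type) (F : set_system T) (FF : Filter F)
  (Q : T -> 'M[R]_d) (u v : T -> 'rV[R]_d) Q0 u0 v0 :
  Q @ F --> Q0 -> u @ F --> u0 -> v @ F --> v0 ->
  (fun x => bform (Q x) (u x) (v x)) @ F --> bform Q0 u0 v0.
Proof.
move=> HQ Hu Hv.
have coord m n (A : T -> 'M[R]_(m, n)) (A0 : 'M[R]_(m, n)) i j : A @ F --> A0 ->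
    (fun x => A x i j) @ F --> A0 i j.
  by move=> HA; exact: (cvg_comp _ _ HA (@coord_continuous R m n i j A0)).
rewrite bformE; under eq_fun do rewrite bformE.
apply: cvg_big => [|i _]; first exact: add_continuous.
apply: cvgM; last exact: coord.
apply: cvg_big => [|j _]; first exact: add_continuous.
by apply: cvgM; exact: coord.
Qed.

End Bform.

Section Curves.
Context {R : realType} {d : nat} {M : metricType R}.
Context {S : smooth_manifold R d M} (g : riemannian_metric S).
Implicit Types (i j : chart_index S) (c : R -> M) (t : R).

Definition gnorm2 i (x u : 'rV[R]_d) : R := bform (metric_mx g i x) u u.

Lemma near_coord_change i j c t :
  (\forall s \near t, chart_dom (atlas i) (c s)) ->
  (\forall s \near t, coord_curve j c s =
     (transition (atlas i) (atlas j) \o coord_curve i c) s).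
Proof.
apply: filterS => s cs.
by rewrite /coord_curve /transition /= chart_funK.
Qed.

Lemma transition_differentiable i j x :
  transition_dom (atlas i) (atlas j) x ->
  differentiable (transition (atlas i) (atlas j)) x.
Proof. by move=> xd; have [+ _] := atlas_smooth i j 1%N; apply. Qed.

Lemma coord_curve_change i j c t :
  (\forall s \near t, chart_dom (atlas i) (c s)) ->
  chart_dom (atlas j) (c t) -> derivable (coord_curve i c) t 1 ->
  is_derive t 1 (coord_curve j c) (derive1 (coord_curve i c) t *m
     'J (transition (atlas i) (atlas j)) (coord_curve i c t)).
Proof.
move=> ci cj ct.
have cit : chart_dom (atlas i) (c t) by exact: nbhs_singleton ci.
have tdom : transition_dom (atlas i) (atlas j) (coord_curve i c t).
  by exists (c t).
have td := transition_differentiable tdom.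
have cd : differentiable (coord_curve i c) t by apply/derivable1_diffP.
have E := near_coord_change j ci.
apply: (@near_eq_is_derive _ _ _
  (transition (atlas i) (atlas j) \o coord_curve i c)).
  by apply: filterS E => s ->.
apply: DeriveDef; first exact/diff_derivable/differentiable_comp.
rewrite deriveE; last exact/differentiable_comp.
rewrite diff_comp//= -derive1E'// -deriveE// deriveEjacobian//.
Qed.

(** The speed may be computed in any chart around the point, not only in the
   one selected by [chart_at]: the Jacobian of the transition that appears in
   the velocity is absorbed by the compatibility of the Gram matrices. *)
Lemma speedE i c t :
  (\forall s \near t, chart_dom (atlas i) (c s)) ->
  derivable (coord_curve i c) t 1 ->
  speed g c t =
  Num.sqrt (gnorm2 i (coord_curve i c t) (derive1 (coord_curve i c) t)).
Proof.
move=> ci ct; rewrite /speed; set j := @chart_at R d M S (c t).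
have cit : chart_dom (atlas i) (c t) by exact: nbhs_singleton ci.
have cj : chart_dom (atlas j) (c t) by rewrite /j /chart_at; case: cid.
have tdom : transition_dom (atlas i) (atlas j) (coord_curve i c t).
  by exists (c t).
have H := coord_curve_change ci cj ct.
rewrite [derive1 (coord_curve j c) t]derive1E derive_val.
congr Num.sqrt.
rewrite /gnorm2 /bform (metric_compat g tdom) /=.
have -> : transition (atlas i) (atlas j) (coord_curve i c t) = coord_curve j c t.
  by rewrite /transition /coord_curve /= chart_funK.
by rewrite trmx_mul !mulmxA.
Qed.

Lemma C1_curve_near_dom i c t : C1_curve (S := S) c -> t \in `[0, 1] ->
  chart_dom (atlas i) (c t) -> \forall s \near t, chart_dom (atlas i) (c s).
Proof.
move=> cC t01 cit; have [cc _] := cC _ t01; apply: cc.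
by apply: open_nbhs_nbhs; split => //; exact: chart_dom_open.
Qed.

Lemma C1_curve_speedE i c t : C1_curve (S := S) c -> t \in `[0, 1] ->
  chart_dom (atlas i) (c t) ->
  speed g c t =
  Num.sqrt (gnorm2 i (coord_curve i c t) (derive1 (coord_curve i c) t)).
Proof.
move=> cC t01 cit; apply: speedE; first exact: C1_curve_near_dom.
by have [_ /(_ _ cit)[+ _]] := cC _ t01; exact: nbhs_singleton.
Qed.

(** The selected chart may jump with t; near a given t, however, the speed is
   also given by one fixed chart, where continuity is visible. *)
Lemma speed_continuous c t : C1_curve (S := S) c -> t \in `[0, 1] ->
  {for t, continuous (speed g c)}.
Proof.
move=> cC t01; have [i cit] := atlas_cover S (c t).
have [cc /(_ _ cit)[cd cdc]] := cC _ t01.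
have nd := C1_curve_near_dom cC t01 cit.
have E : \forall s \near t, speed g c s =
    Num.sqrt (gnorm2 i (coord_curve i c s) (derive1 (coord_curve i c) s)).
  have nnd := near_join nd.
  near=> s; apply: speedE; last by near: s.
  by near: s.
rewrite /prop_for /continuous_at (nbhs_singleton E).
apply: cvg_trans.
  by apply: near_eq_cvg; apply: filterS E => s ->.
apply: continuous_cvg; first exact: sqrt_continuous.
have cct : coord_curve i c @ t --> coord_curve i c t.
  apply: differentiable_continuous; apply/derivable1_diffP.
  exact: nbhs_singleton cd.
apply: cvg_bform => //.
apply: continuous_cvg => //.
have /= := metric_smooth g i 0; apply.
exact: chart_fun_cod.
Unshelve. all: by end_near. Qed.

Lemma gnorm2_ge0 i x u : chart_cod (atlas i) x -> 0 <= gnorm2 i x u.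
Proof.
move=> xi; have [->|u0] := eqVneq u 0.
  by rewrite /gnorm2 /bform !mul0mx mxE.
exact/ltW/metric_posdef.
Qed.

Lemma speed_ge0 c t : 0 <= speed g c t.
Proof. by rewrite /speed sqrtr_ge0. Qed.

Lemma curve_length_ge0 c : 0 <= curve_length g c.
Proof. by apply: Rintegral_ge0 => t _; exact: speed_ge0. Qed.

Definition subcurve c (a b : R) : R -> M := c \o (fun s => a + s * (b - a)).

Lemma affine_in (a b s : R) : 0 <= a -> a <= b -> b <= 1 -> s \in `[0, 1] ->
  (a + s * (b - a)) \in `[0, 1].
Proof.
move=> a0 ab b1 /in01P/andP[s0 s1]; apply/in01P/andP; split; nra.
Qed.

Lemma affine_is_derive (a b s : R) :
  is_derive s 1 (fun s => a + s * (b - a)) (b - a).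
Proof.
apply: is_derive_eq.
by rewrite ?scaler0 ?addr0 ?add0r /GRing.scale/= ?mulr1 ?mulr0 ?add0r mul1r.
Qed.

Lemma affine_continuous (a b : R) : continuous (fun s : R => a + s * (b - a) : R).
Proof.
move=> s; apply: differentiable_continuous; apply/derivable1_diffP.
by have H := affine_is_derive a b s; exact: ex_derive.
Qed.

Lemma near_affine (a b s : R) (P : R -> Prop) :
  (\forall t \near a + s * (b - a), P t) ->
  \forall r \near s, P (a + r * (b - a)).
Proof.
exact: (@affine_continuous a b s [set t | P t]).
Qed.

Lemma subcurve_derive1 (W : normedModType R) (f : R -> W) (a b s : R) :
  derivable f (a + s * (b - a)) 1 ->
  is_derive s 1 (f \o (fun s => a + s * (b - a)))
    ((b - a) *: derive1 f (a + s * (b - a))).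
Proof.
move=> df.
have dff : differentiable f (a + s * (b - a)) by apply/derivable1_diffP.
have H := affine_is_derive a b s.
have dfa : differentiable (fun s : R => a + s * (b - a)) s.
  by apply/derivable1_diffP; exact: ex_derive.
apply: DeriveDef; first exact/diff_derivable/differentiable_comp.
rewrite deriveE; last exact/differentiable_comp.
rewrite diff_comp//= -[X in 'd f _ X]derive1E'// derive1E derive_val.
by rewrite diff1E.
Qed.

Lemma C1_subcurve c (a b : R) : 0 <= a -> a <= b -> b <= 1 ->
  C1_curve (S := S) c -> C1_curve (S := S) (subcurve c a b).
Proof.
move=> a0 ab b1 cC s s01; have t01 := affine_in a0 ab b1 s01.
have [cc cd] := cC _ t01.
have ac := @affine_continuous a b s.
split; first exact: (continuous_comp ac cc).
move=> i /cd[cdi cdc]; split.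
  apply: filterS (near_affine cdi) => r dr.
  by have H := subcurve_derive1 dr; exact: ex_derive.
have E : \forall r \near s,
    derive1 (coord_curve i (subcurve c a b)) r =
    (b - a) *: derive1 (coord_curve i c) (a + r * (b - a)).
  apply: filterS (near_affine cdi) => r dr.
  by have H := subcurve_derive1 dr; rewrite [LHS]derive1E derive_val.
rewrite /prop_for /continuous_at (nbhs_singleton E).
apply: cvg_trans.
  by apply: near_eq_cvg; apply: filterS E => r ->.
apply: (@cvgZl_tmp _ _ _ _ _ (b - a)
  (fun r : R => derive1 (coord_curve i c) (a + r * (b - a)))).
exact: (continuous_comp ac cdc).
Qed.

Lemma speed_subcurve c (a b s : R) : 0 <= a -> a <= b -> b <= 1 ->
  C1_curve (S := S) c -> s \in `[0, 1] ->
  speed g (subcurve c a b) s = (b - a) * speed g c (a + s * (b - a)).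
Proof.
move=> a0 ab b1 cC s01; have t01 := affine_in a0 ab b1 s01.
have [i cit] := atlas_cover S (c (a + s * (b - a))).
rewrite (C1_curve_speedE cC t01 cit).
rewrite (@C1_curve_speedE i)//; last exact: C1_subcurve.
have [_ /(_ _ cit)[/nbhs_singleton cd _]] := cC _ t01.
have H := subcurve_derive1 cd; rewrite [derive1 _ s]derive1E derive_val.
have -> u : gnorm2 i (coord_curve i (subcurve c a b) s) ((b - a) *: u) =
   (b - a) ^+ 2 * gnorm2 i (coord_curve i c (a + s * (b - a))) u.
  rewrite /gnorm2 /bform -!scalemxAl linearZ/= -scalemxAr scalerA mxE.
  by rewrite expr2.
rewrite sqrtrM ?sqr_ge0// sqrtr_sqr ger0_norm//; lra.
Qed.

(** Both the speed of the sub-arcs and their lengths reduce to one primitive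
   of the speed, so lengths become additive without any change of variables
   in integrals. *)
Lemma arclength c : C1_curve (S := S) c ->
  exists F : R -> R,
    (forall t, t \in `[0, 1] -> is_derive t 1 F (speed g c t)) /\
    forall a b, 0 <= a -> a <= b -> b <= 1 ->
      curve_length g (subcurve c a b) = F b - F a.
Proof.
move=> cC.
have [F Fd] := primitive_01 (fun t => @speed_continuous c t cC).
exists F; split => // a b a0 ab b1.
have scC := C1_subcurve a0 ab b1 cC.
pose h := F \o (fun s => a + s * (b - a)).
have -> : F b - F a = h 1 - h 0.
  by rewrite /h /= mul1r mul0r addr0 [a + _]addrC subrK.
have hc t : t \in `[0, 1] -> {for t, continuous (speed g (subcurve c a b))}.
  exact: speed_continuous.
have hd t : t \in `[0, 1] -> is_derive t 1 h (speed g (subcurve c a b) t).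
  move=> t01; have dF := Fd _ (affine_in a0 ab b1 t01).
  have dFt : derivable F (a + t * (b - a)) 1 by exact: ex_derive.
  have H := subcurve_derive1 dFt.
  rewrite speed_subcurve//.
  by move: H; rewrite derive1E derive_val.
exact: FTC2_01 hc hd.
Qed.

Lemma subcurve01 c : subcurve c 0 1 = c.
Proof. by apply/funext => s; rewrite /subcurve /= subr0 mulr1 add0r. Qed.

End Curves.

(** * Paths and the length-space property *)

Section Paths.
Context {R : realType} {d : nat} {M : metricType R}.
Context {S : smooth_manifold R d M} (g : riemannian_metric S).

Lemma mdist_continuous (o : M) : continuous (mdist o : M -> R).
Proof.
move=> x; apply/cvgrPdist_lt => e e0.
have : nbhs x (ball x e) by exact: nbhsx_ballx.
apply: filterS => y; rewrite ballEmdist /= => xy.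
have H1 := metric_triangle o x y; have H2 := metric_triangle o y x.
rewrite (metric_sym y x) in H2.
rewrite ltr_norml; apply/andP; split; lra.
Qed.

Lemma path_length_ge0 p q l : piecewise_C1_path g p q l -> 0 <= l.
Proof.
by elim=> // c q' l' cC _ l0; rewrite addr_ge0// curve_length_ge0.
Qed.

Lemma subarc_path c F (a b : R) q l : C1_curve (S := S) c ->
  (forall a b, 0 <= a -> a <= b -> b <= 1 ->
      curve_length g (subcurve c a b) = F b - F a) ->
  0 <= a -> a <= b -> b <= 1 ->
  piecewise_C1_path g (c b) q l ->
  piecewise_C1_path g (c a) q (F b - F a + l).
Proof.
move=> cC HF a0 ab b1 pq; rewrite -HF//.
have -> : c a = subcurve c a b 0 by rewrite /subcurve /= mul0r addr0.
apply: path_cons; first exact: C1_subcurve.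
by rewrite /subcurve /= mul1r addrC subrK.
Qed.

Lemma linform_derive (f : R -> 'rV[R]_d) (w : 'cV[R]_d) (t : R) :
  derivable f t 1 ->
  is_derive t 1 (fun s => (f s *m w) 0 0) ((derive1 f t *m w) 0 0).
Proof.
move=> ft.
have fk k : is_derive t 1 (fun s => f s 0 k) (derive1 f t 0 k).
  apply: DeriveDef; first by move/derivable_mxP : ft; exact.
  by rewrite derive1E derive_mx// mxE.
have -> : (fun s => (f s *m w) 0 0) = \sum_k (w k 0 \*: (fun s => f s 0 k)).
  apply/funext => s; rewrite mxE fct_sumE; apply: eq_bigr => k _.
  by rewrite mulrC.
have -> : (derive1 f t *m w) 0 0 = \sum_k (w k 0 *: derive1 f t 0 k).
  by rewrite mxE; apply: eq_bigr => k _; rewrite mulrC.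
apply: is_derive_sum => k.
Qed.

Hypothesis hdist : forall x y : M, mdist x y = riemannian_dist g x y.

Lemma mdist_le_path p q l : piecewise_C1_path g p q l -> mdist p q <= l.
Proof.
move=> pq; rewrite hdist; apply: ge_inf => //.
by exists 0 => l'; exact: path_length_ge0.
Qed.

Lemma near_minimal_path p q (e : R) : 0 < e ->
  exists2 l, piecewise_C1_path g p q l & l < mdist p q + e.
Proof.
move=> e0; have [->|pq] := eqVneq p q.
  by exists 0; [exact: path_nil|rewrite mdistxx add0r].
have [E|/set0P[l pl]] := eqVneq [set l | piecewise_C1_path g p q l] set0.
  (* the infimum of the empty set is 0, which would give p = q *)
  have := hdist p q; rewrite /riemannian_dist E inf0 => /mdist_positivity pq'.
  by rewrite pq' eqxx in pq.
have hi : has_inf [set l | piecewise_C1_path g p q l].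
  split; first by exists l.
  by exists 0 => l'; exact: path_length_ge0.
have [l' pl' ll'] := inf_adherent e0 hi.
by exists l' => //; rewrite hdist.
Qed.

(** The distance to o varies continuously along a path, so it takes every
   intermediate value, and the path may be cut where it does. *)
Lemma path_split (o : M) (s : R) p q l : piecewise_C1_path g p q l ->
  mdist o p <= s -> s <= mdist o q ->
  exists z l1 l2, [/\ piecewise_C1_path g p z l1, piecewise_C1_path g z q l2,
    l1 + l2 = l & mdist o z = s].
Proof.
elim=> {p q l} [p ps sp|c q l cC pq IH ps sq].
  exists p, 0, 0; split; [exact: path_nil|exact: path_nil|by rewrite addr0|].
  by apply/eqP; rewrite eq_le ps sp.
have [F [_ HF]] := arclength g cC.
have cl : curve_length g c = F 1 - F 0.
  by rewrite -HF ?subcurve01.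
have [sc1|/ltW c1s] := leP s (mdist o (c 1)); last first.
  have [z [l1 [l2 [pz zq ll oz]]]] := IH c1s sq.
  exists z, (curve_length g c + l1), l2; split => //; last by rewrite -ll addrA.
  exact: path_cons.
have [t t01 ct] : exists2 t, t \in `[0, 1] & mdist o (c t) = s.
  apply: (@IVT _ (mdist o \o c)) => //.
  - apply: continuous_in_subspaceT => t; rewrite inE/= => t01.
    apply: continuous_comp; last exact: mdist_continuous.
    by have [] := cC _ t01.
  - by rewrite ge_min le_max ps sc1 orbT.
move/in01P/andP : t01 => [t0 t1].
exists (c t), (F t - F 0 + 0), (F 1 - F t + l); split => //.
- exact: (subarc_path cC HF _ _ _ (path_nil g _)).
- exact: (subarc_path cC HF _ _ _ pq).
- by rewrite cl; lra.
Qed.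

(** The length-space property: one can move away from p by the exact distance
   s while getting closer to q by s, up to an arbitrarily small error.  This is
   a substitute for minimizing geodesics. *)
Lemma walk_towards (p q : M) (s e : R) : 0 <= s -> s <= mdist p q -> 0 < e ->
  exists2 z, mdist p z = s & mdist z q <= mdist p q - s + e.
Proof.
move=> s0 sd e0; have [l pl ll] := near_minimal_path p q e0.
have [|z [l1 [l2 [pz zq l12 pzs]]]] := path_split (o := p) pl _ sd.
  by rewrite mdistxx.
exists z => //.
have := mdist_le_path pz; have := mdist_le_path zq; lra.
Qed.

(** A calibration argument: where the linear form w is bounded by the norm of
   the metric, its increment along a path is bounded by the length, because
   the derivative of (arc length - w) is nonnegative.  A path which starts at p
   and whose length is less than rho - mdist o p cannot leave the ball where
   the bound holds. *)
Lemma calibration i (o : M) (rho : R) (w : 'cV[R]_d) :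
  (forall z, mdist o z < rho -> chart_dom (atlas i) z /\
     forall u, (u *m w) 0 0 <=
       Num.sqrt (gnorm2 g i (chart_fun (atlas i) z) u)) ->
  forall p q l, piecewise_C1_path g p q l -> mdist o p + l < rho ->
    ((chart_fun (atlas i) q - chart_fun (atlas i) p) *m w) 0 0 <= l.
Proof.
move=> Hw p q l; elim=> {p q l} [p _|c q l cC pq IH lt].
  by rewrite subrr mul0mx mxE.
have [F [Fd HF]] := arclength g cC.
have cl : curve_length g c = F 1 - F 0.
  by rewrite -HF ?subcurve01.
have l0 := path_length_ge0 pq.
have Fmono a b : 0 <= a -> a <= b -> b <= 1 -> F a <= F b.
  by move=> a0 ab b1; rewrite -subr_ge0 -HF// curve_length_ge0.
have oc t : t \in `[0, 1] -> mdist o (c t) < rho.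
  move=> /in01P/andP[t0 t1].
  have := mdist_le_path (subarc_path cC HF (lexx 0) t0 t1 (path_nil g _)).
  have := metric_triangle o (c 0) (c t).
  have := Fmono _ _ t0 t1 (lexx _); move: lt; rewrite cl; lra.
have e1 : (1 : R) \in `[0, 1] by apply/in01P; rewrite lexx ler01.
have e0 : (0 : R) \in `[0, 1] by apply/in01P; rewrite lexx ler01.
have {}IH : ((chart_fun (atlas i) q - chart_fun (atlas i) (c 1)) *m w) 0 0 <= l.
  apply: IH; have := mdist_le_path (subarc_path cC HF (lexx 0) ler01 (lexx 1) (path_nil g _)).
  have := metric_triangle o (c 0) (c 1); move: lt; rewrite cl; lra.
pose xi (t : R) : R := (coord_curve i c t *m w) 0 0.
have Gd (t : R) : t \in `[0, 1] -> is_derive t 1 (F - xi)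
   (speed g c t - (derive1 (coord_curve i c) t *m w) 0 0).
  move=> t01; have [cit _] := Hw _ (oc _ t01).
  have [_ /(_ _ cit)[/nbhs_singleton cd _]] := cC _ t01.
  have H1 := linform_derive w cd; have H2 := Fd _ t01.
  exact: is_deriveB.
have sub t : t \in `]0, 1[ -> t \in `[0, 1] :> Prop.
  by rewrite !in_itv/= => /andP[/ltW-> /ltW->].
have : (F - xi) 0 <= (F - xi) 1.
  apply: (@ger0_derive1_le_cc _ _ 0 1) => //.
  - by move=> t /sub /Gd H; exact: ex_derive.
  - move=> t /sub t01; have H := Gd _ t01; rewrite derive1E derive_val subr_ge0.
    have [cit Hu] := Hw _ (oc _ t01).
    by rewrite (C1_curve_speedE g cC t01 cit); exact: Hu.
  - apply: continuous_in_subspaceT => t; rewrite inE/= => /Gd H.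
    by apply: differentiable_continuous; apply/derivable1_diffP; exact: ex_derive.
move: IH; rewrite cl /xi /coord_curve !fctE /= !mulmxBl !mxE.
lra.
Qed.

End Paths.

(** * Coordinate segments *)

Section Segments.
Context {R : realType} {d : nat} {M : metricType R}.
Context {S : smooth_manifold R d M} (g : riemannian_metric S).
Implicit Types (i j : chart_index S) (x y v : 'rV[R]_d).

Lemma line_is_derive (W : normedModType R) (x v : W) (t : R) :
  is_derive t 1 (fun s : R => x + s *: v) v.
Proof.
have H : is_derive t 1 (cst x + (fun s : R => s *: v)) (0 + v).
  apply: is_deriveD; apply: DeriveDef.
    by apply/derivable1_diffP.
  by rewrite deriveE// diff_val scale1r.
by rewrite add0r in H.
Qed.

Lemma line_continuous (W : normedModType R) (x v : W) :
  continuous (fun s : R => x + s *: v).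
Proof.
move=> s; apply: differentiable_continuous; apply/derivable1_diffP.
by have H := line_is_derive x v s; exact: ex_derive.
Qed.

Lemma near_line (W : normedModType R) (x v : W) (t : R) (P : W -> Prop) :
  (\forall z \near x + t *: v, P z) -> \forall s \near t, P (x + s *: v).
Proof. exact: (@line_continuous W x v t [set z | P z]). Qed.

Lemma line_comp_is_derive (W : normedModType R) (f : 'rV[R]_d -> W) x v t :
  differentiable f (x + t *: v) ->
  is_derive t 1 (fun s : R => f (x + s *: v)) ('D_v f (x + t *: v)).
Proof.
move=> fd; pose l (s : R) := x + s *: v.
have H := line_is_derive x v t.
have ld : differentiable l t by apply/derivable1_diffP; exact: ex_derive.
rewrite -[fun s : R => _]/(f \o l).
apply: DeriveDef; first exact/diff_derivable/differentiable_comp.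
rewrite deriveE; last exact/differentiable_comp.
by rewrite diff_comp//= deriveE// -[in LHS]derive1E'// derive1E derive_val.
Qed.

Lemma chart_inv_cvg i x : chart_cod (atlas i) x ->
  {for x, continuous (chart_inv (atlas i))}.
Proof.
move=> xi; have := chart_inv_continuous (c := atlas i).
rewrite continuous_open_subspace; last exact: chart_cod_open.
by apply; rewrite inE.
Qed.

Lemma chart_fun_cvg i p : chart_dom (atlas i) p ->
  {for p, continuous (chart_fun (atlas i))}.
Proof.
move=> pi; have := chart_fun_continuous (c := atlas i).
rewrite continuous_open_subspace; last exact: chart_dom_open.
by apply; rewrite inE.
Qed.

(** In the coordinates of another chart the segment is a transition map
   restricted to a line, so its velocity is a directional derivative of the
   transition. *)
Lemma segment_C1 i x v :
  (forall t : R, t \in `[0, 1] -> chart_cod (atlas i) (x + t *: v)) ->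
  C1_curve (S := S) (fun t => chart_inv (atlas i) (x + t *: v)).
Proof.
move=> xv t t01; have xt := xv _ t01.
have ncod : \forall z \near x + t *: v, chart_cod (atlas i) z.
  by apply: open_nbhs_nbhs; split => //; exact: chart_cod_open.
have cc : {for t, continuous (fun t : R => chart_inv (atlas i) (x + t *: v))}.
  exact: (continuous_comp (@line_continuous _ x v t) (chart_inv_cvg xt)).
split=> // j cj.
pose tau := transition (atlas i) (atlas j).
have ndom : \forall z \near x + t *: v,
    transition_dom (atlas i) (atlas j) z.
  have nj : \forall z \near x + t *: v, chart_dom (atlas j) (chart_inv (atlas i) z).
    apply: (chart_inv_cvg xt).
    by apply: open_nbhs_nbhs; split => //; exact: chart_dom_open.
  apply: filterS2 ncod nj => z zi zj.
  exists (chart_inv (atlas i) z); last exact: chart_invK.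
  by split => //; exact: chart_inv_dom.
have [dtau ctau] := atlas_smooth i j 1%N.
have nd : \forall s \near t, is_derive (s : R) (1 : R)
    (coord_curve j (fun t : R => chart_inv (atlas i) (x + t *: v)))
    ('D_v tau (x + s *: v)).
  apply: filterS (near_line ndom) => s sd.
  by apply: (@line_comp_is_derive _ tau); exact: dtau.
split; first by apply: filterS nd => s H; exact: ex_derive.
have E : \forall s \near t,
    derive1 (coord_curve j (fun t : R => chart_inv (atlas i) (x + t *: v))) s =
    'D_v tau (x + s *: v).
  by apply: filterS nd => s H; rewrite derive1E derive_val.
rewrite /prop_for /continuous_at (nbhs_singleton E).
apply: cvg_trans.
  by apply: near_eq_cvg; apply: filterS E => r ->.
have ct : {for x + t *: v, continuous ('D_v tau)}.
  exact: (ctau v _ (nbhs_singleton ndom)).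
exact: (continuous_comp (@line_continuous _ x v t) ct).
Qed.

Lemma segment_speed i x v (t : R) :
  (forall t : R, t \in `[0, 1] -> chart_cod (atlas i) (x + t *: v)) ->
  t \in `[0, 1] ->
  speed g (fun t => chart_inv (atlas i) (x + t *: v)) t =
    Num.sqrt (gnorm2 g i (x + t *: v) v).
Proof.
move=> xv t01; have xt := xv _ t01.
have ncod : \forall z \near x + t *: v, chart_cod (atlas i) z.
  by apply: open_nbhs_nbhs; split => //; exact: chart_cod_open.
rewrite (@C1_curve_speedE _ _ _ _ g i)//; first last.
- exact: chart_inv_dom.
- exact: segment_C1.
have E : \forall s \near t, x + s *: v =
    coord_curve i (fun t : R => chart_inv (atlas i) (x + t *: v)) s.
  apply: filterS (near_line ncod) => s si.
  by rewrite /coord_curve /= chart_invK.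
rewrite -(nbhs_singleton E).
have H := near_eq_is_derive E (line_is_derive x v t).
by rewrite derive1E derive_val.
Qed.

(** Coordinate segments are admissible curves, so their length bounds the
   distance from above. *)
Lemma segment_upper i x v (K : R) :
  (forall x y : M, mdist x y = riemannian_dist g x y) ->
  (forall t : R, t \in `[0, 1] -> chart_cod (atlas i) (x + t *: v)) ->
  (forall t : R, t \in `[0, 1] -> gnorm2 g i (x + t *: v) v <= K ^+ 2) ->
  0 <= K ->
  mdist (chart_inv (atlas i) x) (chart_inv (atlas i) (x + v)) <= K.
Proof.
move=> hdist xv vK K0.
pose c (t : R) := chart_inv (atlas i) (x + t *: v).
have cC : C1_curve (S := S) c by exact: segment_C1.
have [F [Fd HF]] := arclength g cC.
have := mdist_le_path hdist (path_cons cC (path_nil g (c 1))).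
rewrite {1 2}/c scale0r addr0 scale1r addr0 => /le_trans; apply.
rewrite -(subcurve01 c) HF//.
have oc (t : R) : t \in `]0, 1[ -> t \in `[0, 1] :> Prop.
  by rewrite !in_itv/= => /andP[/ltW-> /ltW->].
have Fdo (t : R) : t \in `]0, 1[ -> is_derive t 1 F (speed g c t).
  by move=> /oc /Fd.
have Fc : {within `[0, 1], continuous F}.
  apply: continuous_in_subspaceT => t; rewrite inE/= => /Fd H.
  by apply: differentiable_continuous; apply/derivable1_diffP; exact: ex_derive.
have [t t01 ->] := MVT ltr01 Fdo Fc.
rewrite subr0 mulr1 segment_speed//; last exact: oc.
rewrite -[leRHS](ger0_norm K0) -sqrtr_sqr ler_sqrt ?sqr_ge0//.
exact: vK (oc _ t01).
Qed.

End Segments.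

(** * Matrix norms and bilinear forms *)

Section MatrixNorm.
Context {R : realType}.

Lemma mx_entry_le m n (A : 'M[R]_(m, n)) i j : `|A i j| <= `|A|.
Proof.
rewrite [leRHS]/Num.norm /= mx_normrE.
exact: (le_bigmax _ (fun ij => `|A ij.1 ij.2|) (i, j)).
Qed.

Lemma mx_norm_le m n (A : 'M[R]_(m, n)) (e : R) : 0 <= e ->
  (forall i j, `|A i j| <= e) -> `|A| <= e.
Proof.
move=> e0 Ae; rewrite [leLHS]/Num.norm /= mx_normrE.
by apply: bigmax_le => // -[i j] _ /=.
Qed.

Lemma ball_segment d (a x y : 'rV[R]_d) (r t : R) :
  `|x - a| < r -> `|y - a| < r -> t \in `[0, 1] ->
  `|x + t *: (y - x) - a| < r.
Proof.
move=> xa ya /in01P/andP[t0 t1].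
have -> : x + t *: (y - x) - a = (1 - t) *: (x - a) + t *: (y - a).
  by rewrite !scalerBr !scalerBl !scale1r; apply/rowP => k; rewrite !mxE; ring.
apply: le_lt_trans (ler_normD _ _) _; rewrite !normrZ.
rewrite (ger0_norm t0) (@ger0_norm _ (1 - t)) ?subr_ge0//.
set p := `|x - a|; set q := `|y - a|.
have mr : Num.max p q < r by rewrite gt_max xa ya.
apply: le_lt_trans mr.
have pm : p <= Num.max p q by rewrite le_max lexx.
have qm : q <= Num.max p q by rewrite le_max lexx orbT.
move: (Num.max p q) pm qm => K pm qm; nra.
Qed.

(** The partial derivatives are bounded near a; the mean value theorem on
   segments, applied to each entry, does the rest. *)
Lemma C1_locally_lipschitz d m n (U : set 'rV[R]_d) (f : 'rV[R]_d -> 'M[R]_(m, n)) a :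
  open U -> Ck_on 1 U f -> U a ->
  exists r L : R, [/\ 0 < r, 0 <= L, forall x, `|x - a| < r -> U x &
    forall x y, `|x - a| < r -> `|y - a| < r -> `|f y - f x| <= L * `|y - x|].
Proof.
move=> Uo [fd fc] Ua.
pose e k : 'rV[R]_d := delta_mx 0 k.
have [r r0 Hr] : exists2 r : R, 0 < r & forall x, `|x - a| < r ->
    U x /\ forall k, `|'D_(e k) f x| <= `|'D_(e k) f a| + 1.
  have H : \forall x \near a, U x /\ forall k, `|'D_(e k) f x| <= `|'D_(e k) f a| + 1.
    near=> x; split.
      by near: x; apply: open_nbhs_nbhs.
    near: x; apply: filter_forall => k.
    have := fc (e k) _ Ua.
    move=> /cvgrPdist_lt /(_ 1 ltr01); apply: filterS => x xk.
    rewrite -lerBlDl; apply: le_trans (lerB_dist _ _) _.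
    by rewrite distrC ltW.
  have /nbhs_ballP[r r0 Hr] := H; exists r => // x xa.
  by apply: Hr; rewrite -ball_normE /ball_ /= distrC.
pose L := \sum_k (`|'D_(e k) f a| + 1).
have L0 : 0 <= L by apply: sumr_ge0 => k _; rewrite addr_ge0.
exists r, L; split => //.
  by move=> x /Hr[].
move=> x y xa ya; set v := y - x.
have seg (t : R) : t \in `[0, 1] -> `|x + t *: v - a| < r.
  exact: ball_segment.
have Dv (z : 'rV[R]_d) : `|z - a| < r -> `|'D_v f z| <= L * `|v|.
  move=> za; have [Uz Bz] := Hr _ za.
  rewrite deriveE; last exact: fd.
  rewrite [v in 'd f z v]row_sum_delta linear_sum mulr_suml.
  apply: le_trans (ler_norm_sum _ _ _) _; apply: ler_sum => k _.
  rewrite linearZ normrZ mulrC -deriveE; last exact: fd.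
  by apply: ler_pM => //; exact: mx_entry_le.
apply: mx_norm_le; first by rewrite mulr_ge0.
move=> i j.
pose h (t : R) : R := f (x + t *: v) i j.
have hd (t : R) : t \in `[0, 1] -> is_derive t 1 h (('D_v f (x + t *: v)) i j).
  move=> t01; have [Ut _] := Hr _ (seg _ t01).
  have H := line_comp_is_derive (fd _ Ut).
  apply: DeriveDef.
    have : derivable (fun s : R => f (x + s *: v)) t 1 by exact: ex_derive.
    by move=> /derivable_mxP; exact.
  have : derivable (fun s : R => f (x + s *: v)) t 1 by exact: ex_derive.
  by move=> /derive_mx; rewrite derive_val => ->; rewrite mxE.
have hdo (t : R) : t \in `]0, 1[ -> is_derive t 1 h (('D_v f (x + t *: v)) i j).
  by rewrite in_itv/= => /andP[t0 t1]; apply: hd; rewrite in_itv/= !ltW.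
have hc : {within `[0, 1], continuous h}.
  apply: continuous_in_subspaceT => t; rewrite inE/= => /hd H.
  by apply: differentiable_continuous; apply/derivable1_diffP; exact: ex_derive.
have [t t01] := MVT ltr01 hdo hc.
rewrite /h scale1r scale0r addr0 subr0 mulr1 !mxE [x + v]addrC subrK => ->.
apply: le_trans (mx_entry_le _ _ _) _; apply: Dv; apply: seg.
by move: t01; rewrite !in_itv/= => /andP[/ltW-> /ltW->].
Unshelve. all: by end_near. Qed.

End MatrixNorm.

Section BformAlgebra.
Context {R : realType} {d : nat}.
Implicit Types (Q : 'M[R]_d) (u v w : 'rV[R]_d).

Lemma bformDl Q u v w : bform Q (u + v) w = bform Q u w + bform Q v w.
Proof. by rewrite /bform !mulmxDl mxE. Qed.

Lemma bformZl Q (a : R) u v : bform Q (a *: u) v = a * bform Q u v.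
Proof. by rewrite /bform -!scalemxAl mxE. Qed.

Lemma bform0l Q v : bform Q 0 v = 0.
Proof. by rewrite /bform !mul0mx mxE. Qed.

Lemma bform_sym Q u v : Q^T = Q -> bform Q u v = bform Q v u.
Proof.
move=> Qs; rewrite /bform.
have -> : u *m Q *m v^T = (v *m Q *m u^T)^T.
  by rewrite !trmx_mul trmxK Qs mulmxA.
by rewrite mxE.
Qed.

Lemma bformDr Q u v w : bform Q w (u + v) = bform Q w u + bform Q w v.
Proof. by rewrite /bform linearD mulmxDr mxE. Qed.

Lemma bformZr Q (a : R) u v : bform Q v (a *: u) = a * bform Q v u.
Proof. by rewrite /bform linearZ /= -scalemxAr mxE. Qed.

Lemma bformB Q Q' u v : bform (Q - Q') u v = bform Q u v - bform Q' u v.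
Proof. by rewrite /bform mulmxBr mulmxBl !mxE. Qed.

Lemma bform_le Q u v : `|bform Q u v| <= (d ^ 2)%:R * `|Q| * `|u| * `|v|.
Proof.
rewrite bformE; apply: le_trans (ler_norm_sum _ _ _) _.
have -> : (d ^ 2)%:R * `|Q| * `|u| * `|v| =
    \sum_(i < d) \sum_(j < d) `|u| * `|Q| * `|v|.
  rewrite !sumr_const !card_ord -mulrnA expnS expn1 -[RHS]mulr_natl.
  by rewrite -!mulrA; congr (_ * _); rewrite mulrCA.
apply: ler_sum => i _; rewrite normrM -mulr_suml.
apply: ler_pM => //; last exact: mx_entry_le.
apply: le_trans (ler_norm_sum _ _ _) _; apply: ler_sum => j _.
by rewrite normrM; apply: ler_pM => //; exact: mx_entry_le.
Qed.

Lemma bform_CS Q u v : Q^T = Q -> (forall w, w != 0 -> 0 < bform Q w w) ->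
  bform Q u v ^+ 2 <= bform Q u u * bform Q v v.
Proof.
move=> Qs Qp; have [->|v0] := eqVneq v 0.
  by rewrite (bform_sym u 0 Qs) !bform0l mulr0 expr0n.
have vv := Qp _ v0.
have ge0 w : 0 <= bform Q w w.
  have [->|w0] := eqVneq w 0; last exact/ltW/Qp.
  by rewrite bform0l.
have := ge0 (bform Q v v *: u - bform Q u v *: v).
rewrite -scaleNr !(bformDl, bformDr, bformZl, bformZr) (bform_sym v u Qs).
move: (bform Q u u) (bform Q u v) (bform Q v v) vv => a b c c0 H.
rewrite -(ler_pM2l c0); nra.
Qed.

(** Compactness of the unit sphere of the sup norm. *)
Lemma bform_coercive Q : (forall w, w != 0 -> 0 < bform Q w w) ->
  exists2 lam : R, 0 < lam & forall u, lam * `|u| ^+ 2 <= bform Q u u.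
Proof.
move=> Qp; pose A := [set u : 'rV[R]_d | `|u| = 1].
have [A0|/set0P A0] := eqVneq A set0.
  exists 1 => // u; have [->|u0] := eqVneq u 0.
    by rewrite normr0 expr0n mulr0 bform0l.
  suff : A (`|u|^-1 *: u) by rewrite A0.
  by rewrite /A /= normrZ ger0_norm ?invr_ge0// mulVf ?normr_eq0.
have cA : compact A.
  apply: bounded_closed_compact.
    by exists 1; split => // x x1 u /= ->; exact: ltW.
  apply: (@closed_comp _ _ (fun u : 'rV[R]_d => `|u|) [set 1]).
    by move=> u _; exact: norm_continuous.
  exact: closed_eq.
have cf : {within A, continuous (fun u => bform Q u u)}.
  apply: continuous_subspaceT => u.
  apply: (@cvg_bform R d _ (nbhs u) _ (cst Q) id id Q u u).
  - exact: cvg_cst.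
  - exact: cvg_id.
  - exact: cvg_id.
have [c /set_mem cA1 cmin] := compact_EVT_min A0 cA cf.
exists (bform Q c c).
  by apply: Qp; rewrite -normr_eq0 cA1 oner_eq0.
move=> u; have [->|u0] := eqVneq u 0.
  by rewrite normr0 expr0n mulr0 bform0l.
have un : `|u| != 0 by rewrite normr_eq0.
have := cmin (`|u|^-1 *: u).
rewrite inE /A /= normrZ ger0_norm ?invr_ge0// mulVf// => /(_ erefl).
rewrite bformZl bformZr mulrA -expr2 exprVn ler_pdivlMl ?exprn_gt0 ?normr_gt0//.
by rewrite mulrC.
Qed.

End BformAlgebra.

(** * The distance in coordinates *)

(** Everything that is needed about the metric near p0, in coordinates psi with
   inverse P: the distance is Lipschitz equivalent to the norm, and its square
   agrees with the quadratic form Q x up to an error of third order.  The other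
   fields say that Q x is uniformly positive and Lipschitz in x.  One constant
   lam serves for all lower bounds and one constant Lam for all upper bounds. *)
Record local_model {R : realType} {d : nat} {M : metricType R} (p0 : M)
  (P : 'rV[R]_d -> M) (psi : M -> 'rV[R]_d) (Q : 'rV[R]_d -> 'M[R]_d)
  (r rho lam Lam : R) : Prop := LocalModel {
  lm_r : 0 < r;
  lm_rho : 0 < rho;
  lm_lam : 0 < lam;
  lm_Lam : 0 < Lam;
  lm_coord : forall z, mdist p0 z < rho ->
    `|psi z - psi p0| < r / 2 /\ P (psi z) = z;
  lm_lower : forall x y, `|x - psi p0| < r -> `|y - psi p0| < r ->
    lam * `|y - x| <= mdist (P x) (P y);
  lm_upper : forall x y, `|x - psi p0| < r -> `|y - psi p0| < r ->
    mdist (P x) (P y) <= Lam * `|y - x|;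
  lm_sym : forall x, `|x - psi p0| < r -> (Q x)^T = Q x;
  lm_coercive : forall x u, `|x - psi p0| < r ->
    lam * `|u| ^+ 2 <= bform (Q x) u u;
  lm_bounded : forall x u v, `|x - psi p0| < r ->
    `|bform (Q x) u v| <= Lam * `|u| * `|v|;
  lm_lipschitz : forall x y u v, `|x - psi p0| < r -> `|y - psi p0| < r ->
    `|bform (Q x) u v - bform (Q y) u v| <= Lam * `|y - x| * `|u| * `|v|;
  lm_square : forall x y, `|x - psi p0| < r -> `|y - psi p0| < r ->
    `|mdist (P x) (P y) ^+ 2 - bform (Q x) (y - x) (y - x)|
      <= Lam * `|y - x| ^+ 3 }.

Section LocalModel.
Context {R : realType} {d : nat} {M : metricType R}.
Context {S : smooth_manifold R d M} (g : riemannian_metric S).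
Hypothesis hdist : forall x y : M, mdist x y = riemannian_dist g x y.

(** Calibration by lam times a coordinate form: since lam <= 1, its square is at
   most lam * |u| ^ 2, hence below the metric. *)
Lemma dist_coord_lower i (o p q : M) (rho lam : R) : 0 < lam ->
  lam <= 1 ->
  (forall z, mdist o z < rho -> chart_dom (atlas i) z /\
     forall u, lam * `|u| ^+ 2 <= gnorm2 g i (chart_fun (atlas i) z) u) ->
  mdist o p + mdist p q < rho ->
  lam * `|chart_fun (atlas i) q - chart_fun (atlas i) p| <= mdist p q.
Proof.
move=> lam0 lam1 Hz opq.
rewrite -ler_pdivlMl//.
apply: mx_norm_le.
  by apply: mulr_ge0; [rewrite invr_ge0 ltW|exact: mdist_ge0].
move=> i0 k; rewrite (ord1 i0) ler_pdivlMl//; apply/ler_addgt0Pr => e e0.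
have [eta [eta0 etae etar]] : exists eta : R,
    [/\ 0 < eta, eta <= e & mdist o p + (mdist p q + eta) < rho].
  exists (Num.min e ((rho - (mdist o p + mdist p q)) / 2)); split.
  - by rewrite lt_min e0 divr_gt0// subr_gt0.
  - by rewrite ge_min lexx.
  - have : Num.min e ((rho - (mdist o p + mdist p q)) / 2) <=
      (rho - (mdist o p + mdist p q)) / 2 by rewrite ge_min lexx orbT.
    lra.
have [l pl ll] := near_minimal_path hdist p q eta0.
(* both signs of the coordinate form, at once *)
have key (s : R) : s ^+ 2 = 1 ->
    s * lam * (chart_fun (atlas i) q - chart_fun (atlas i) p) 0 k <= l.
  move=> s1; pose w : 'cV[R]_d := (s * lam) *: delta_mx k 0.
  have wE (u : 'rV[R]_d) : (u *m w) 0 0 = s * lam * u 0 k.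
    by rewrite /w -scalemxAr mxE -colE mxE.
  rewrite -wE; apply: (calibration (g := g) hdist (rho := rho) (o := o) _ pl); last first.
    lra.
  move=> z oz; have [zi zu] := Hz _ oz; split=> // u; rewrite wE.
  apply: le_trans (ler_norm _) _; rewrite -sqrtr_sqr ler_sqrt; last first.
    by apply: gnorm2_ge0; exact: chart_fun_cod.
  apply: le_trans (zu u).
  rewrite !exprMn s1 mul1r -[u 0 k ^+ 2]real_normK ?num_real//.
  have := mx_entry_le u 0 k; have := normr_ge0 (u 0 k).
  move: `|u 0 k| `|u| => a b a0 ab.
  have ab2 : a ^+ 2 <= b ^+ 2 by rewrite ler_sqr ?nnegrE//; lra.
  have := sqr_ge0 a; nra.
have k1 := key 1 (expr1n _ _).
have k2 : - 1 * lam * (chart_fun (atlas i) q - chart_fun (atlas i) p) 0 k <= l.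
  by apply: key; rewrite sqrrN expr1n.
rewrite -[lam in lam * _](gtr0_norm lam0) -normrM ler_norml.
by apply/andP; split; lra.
Qed.

(** Calibration by the form u |-> <u, v>_x, scaled so that, by the
   Cauchy-Schwarz inequality for Q x, it is below the norm at every point of the
   ball, where the metric is at least (1 - theta) times the metric at x. *)
Lemma dist_sq_lower i (x v : 'rV[R]_d) (q : M) (theta l0 : R) :
  chart_cod (atlas i) x ->
  chart_fun (atlas i) q - x = v ->
  mdist (chart_inv (atlas i) x) q < l0 ->
  (forall z, mdist (chart_inv (atlas i) x) z < l0 -> chart_dom (atlas i) z /\
     forall u, (1 - theta) * gnorm2 g i x u <=
               gnorm2 g i (chart_fun (atlas i) z) u) ->
  (1 - theta) * gnorm2 g i x v <= l0 ^+ 2.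
Proof.
move=> xi qv xq Hz; set p := chart_inv (atlas i) x.
have N0 : 0 <= gnorm2 g i x v by exact: gnorm2_ge0.
have [th1|th1] := leP (1 - theta) 0.
  by apply: le_trans (sqr_ge0 _); nra.
have [v0|v0] := eqVneq v 0.
  by rewrite v0 /gnorm2 bform0l mulr0 sqr_ge0.
have Npos u : u != 0 -> 0 < bform (metric_mx g i x) u u by exact: metric_posdef.
have {}N0 : 0 < gnorm2 g i x v by exact: Npos.
have Qs := Defs.metric_sym g xi.
set N := gnorm2 g i x v in N0 *.
(* the scaling for which equality holds in the bound at u = v *)
pose s := Num.sqrt ((1 - theta) / N).
have s2 : s ^+ 2 = (1 - theta) / N.
  by rewrite sqr_sqrtr// divr_ge0// ltW.
pose w : 'cV[R]_d := s *: (metric_mx g i x *m v^T).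
have wE u : (u *m w) 0 0 = s * bform (metric_mx g i x) u v.
  by rewrite /w -scalemxAr mxE mulmxA.
have [l pl ll] : exists2 l, piecewise_C1_path g p q l & l < l0.
  have e0 : 0 < l0 - mdist p q by rewrite subr_gt0.
  have [l pl ll] := near_minimal_path hdist p q e0.
  by exists l => //; move: ll; rewrite addrC subrK.
have sN : s * N <= l.
  have -> : s * N = ((chart_fun (atlas i) q - chart_fun (atlas i) p) *m w) 0 0.
    by rewrite wE /p chart_invK// qv.
  apply: (calibration (g := g) hdist (rho := l0) (o := p) _ pl); last first.
    by rewrite mdistxx add0r.
  move=> z pz; have [zi zu] := Hz _ pz; split=> // u; rewrite wE.
  apply: le_trans (ler_norm _) _; rewrite -sqrtr_sqr ler_sqrt; last first.
    by apply: gnorm2_ge0; exact: chart_fun_cod.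
  apply: le_trans (zu u); rewrite exprMn s2.
  have := bform_CS u v Qs Npos.
  rewrite -/(gnorm2 g i x v) -/N => H.
  rewrite mulrAC ler_pdivrMr// -mulrA ler_pM2l//.
have -> : (1 - theta) * N = (s * N) ^+ 2.
  by rewrite exprMn s2 expr2 mulrA divfK// gt_eqF.
rewrite ler_sqr ?nnegrE; [lra| |].
- by rewrite mulr_ge0 ?sqrtr_ge0// ltW.
- have : 0 <= s * N by rewrite mulr_ge0 ?sqrtr_ge0// ltW.
  lra.
Qed.

End LocalModel.

Section ExistsLocalModel.
Context {R : realType} {d : nat} {M : metricType R}.
Context {S : smooth_manifold R d M} (g : riemannian_metric S).
Hypothesis hdist : forall x y : M, mdist x y = riemannian_dist g x y.

Lemma metric_local_bounds i a : chart_cod (atlas i) a ->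
  exists r lam L K : R, [/\ [/\ 0 < r, 0 < lam, lam <= 1, 0 <= L & 0 <= K],
    forall x, `|x - a| < r -> chart_cod (atlas i) x,
    forall x u, `|x - a| < r -> lam * `|u| ^+ 2 <= gnorm2 g i x u,
    forall x u v, `|x - a| < r ->
      `|bform (metric_mx g i x) u v| <= K * `|u| * `|v| &
    forall x y u v, `|x - a| < r -> `|y - a| < r ->
      `|bform (metric_mx g i x) u v - bform (metric_mx g i y) u v|
        <= L * `|y - x| * `|u| * `|v|].
Proof.
move=> ai.
have [r1 [L0 [r10 L00 B1 Lip]]] := C1_locally_lipschitz
  (chart_cod_open (c := atlas i)) (metric_smooth g i 1%N) ai.
set Q := metric_mx g i.
pose L := (d ^ 2)%:R * L0.
have L_ge0 : 0 <= L by rewrite mulr_ge0.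
have LipB x y u v : `|x - a| < r1 -> `|y - a| < r1 ->
    `|bform (Q x) u v - bform (Q y) u v| <= L * `|y - x| * `|u| * `|v|.
  move=> xa ya; rewrite -bformB; apply: le_trans (bform_le _ _ _) _.
  apply: ler_wpM2r => //; apply: ler_wpM2r => //.
  by rewrite /L -mulrA; apply: ler_wpM2l => //; rewrite (distrC y); exact: Lip.
have Qpos : forall w, w != 0 -> 0 < bform (Q a) w w.
  by move=> w; exact: metric_posdef.
have [mu mu0 Hmu] := bform_coercive Qpos.
have L1 : 0 < 2 * (L + 1) by lra.
pose r := Num.min r1 (mu / (2 * (L + 1))).
have r0 : 0 < r by rewrite lt_min r10 divr_gt0.
have rr1 x : `|x - a| < r -> `|x - a| < r1 by rewrite lt_min => /andP[].
have rmu x : `|x - a| < r -> L * `|x - a| <= mu / 2.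
  rewrite lt_min => /andP[_]; rewrite ltr_pdivlMr// => H.
  have := normr_ge0 (x - a); nra.
have aa : `|a - a| < r1 by rewrite subrr normr0.
pose K := (d ^ 2)%:R * `|Q a| + mu / 2.
exists r, (Num.min (mu / 2) 1), L, K; split.
- split => //.
  + by rewrite lt_min ltr01 divr_gt0.
  + by rewrite ge_min lexx orbT.
  + by rewrite addr_ge0 ?mulr_ge0// ltW.
- by move=> x /rr1 /B1.
- move=> x u xa; apply: (@le_trans _ _ (mu / 2 * `|u| ^+ 2)).
    by apply: ler_wpM2r; [exact: sqr_ge0|rewrite ge_min lexx].
  have := LipB a x u u aa (rr1 _ xa); have := Hmu u; have := rmu _ xa.
  rewrite /gnorm2 -/(Q x) => H1 H2 H3.
  have H4 : L * `|x - a| * `|u| * `|u| <= mu / 2 * `|u| ^+ 2.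
    by rewrite -mulrA -expr2; apply: ler_wpM2r => //; exact: sqr_ge0.
  have := ler_norm (bform (Q a) u u - bform (Q x) u u); lra.
- move=> x u v xa.
  have H1 := LipB a x u v aa (rr1 _ xa); have H2 := bform_le (Q a) u v.
  have H4 : L * `|x - a| * `|u| * `|v| <= mu / 2 * `|u| * `|v|.
    by do 2!apply: ler_wpM2r => //; exact: rmu.
  have H3 := ler_normB (bform (Q a) u v) (bform (Q a) u v - bform (Q x) u v).
  rewrite opprB addrC subrK in H3.
  by rewrite /K !mulrDl; lra.
- by move=> x y u v /rr1 xa /rr1 ya; exact: LipB.
Qed.

(** The upper bounds come from coordinate segments.  For the lower bounds, a
   path that is almost minimizing between two nearby points stays in a small
   ball, where the calibrations apply.  The bound
     (1 - c D) Q_x(y - x) <= D ^ 2,   D = mdist (P x) (P y),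
   is obtained with D replaced by D + eta, for every small eta, and then has an
   error of third order since D and |y - x| are comparable. *)
Lemma exists_local_model (p0 : M) :
  exists P psi Q (r rho lam Lam : R),
    local_model (d := d) p0 P psi Q r rho lam Lam.
Proof.
have [i pi] := atlas_cover S p0.
set psi := chart_fun (atlas i); set P := chart_inv (atlas i).
set a := psi p0; set Q := metric_mx g i.
have ai : chart_cod (atlas i) a by exact: chart_fun_cod.
have [r2 [lam [L [K [[r20 lam0 lam1 L_ge0 K_ge0] cod coer bnd lip]]]]] :=
  metric_local_bounds ai.
pose Kp := K + 1.
have Kp0 : 0 < Kp by rewrite /Kp; lra.
have dist2_up x y : `|x - a| < r2 -> `|y - a| < r2 ->
    mdist (P x) (P y) ^+ 2 <= bform (Q x) (y - x) (y - x) + L * `|y - x| ^+ 3.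
  move=> xa ya; set v := y - x; set T := (X in _ <= X).
  have T0 : 0 <= T.
    rewrite addr_ge0//; last by rewrite mulr_ge0// exprn_ge0.
    exact: le_trans (mulr_ge0 (ltW lam0) (sqr_ge0 _)) (coer _ _ xa).
  rewrite -(sqr_sqrtr T0) ler_sqr ?nnegrE ?mdist_ge0 ?sqrtr_ge0//.
  have -> : y = x + v by rewrite /v addrC subrK.
  apply: (segment_upper (g := g)) => //.
  + by move=> t t01; apply: cod; exact: ball_segment.
  + move=> t t01; rewrite sqr_sqrtr// /T.
    have xt := ball_segment xa ya t01.
    have := lip _ _ v v xa xt; rewrite -/v [x + _]addrC addrK normrZ.
    move/in01P/andP : t01 => [t0 t1]; rewrite ger0_norm// => H.
    have H2 : L * (t * `|v|) * `|v| * `|v| <= L * `|v| ^+ 3.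
      rewrite -!mulrA; apply: ler_wpM2l => //.
      rewrite [leRHS](_ : _ = 1 * (`|v| * (`|v| * `|v|))).
        by apply: ler_wpM2r => //; rewrite !mulr_ge0.
      by rewrite mul1r -expr2 -exprS.
    have := ler_norm (- (bform (Q x) v v - bform (Q (t *: v + x)) v v)).
    by rewrite normrN /gnorm2 -/(Q _); lra.
have dist_up x y : `|x - a| < r2 -> `|y - a| < r2 ->
    mdist (P x) (P y) <= Kp * `|y - x|.
  move=> xa ya.
  have -> : y = x + (y - x) by rewrite addrC subrK.
  rewrite [x + _ - x]addrC addKr.
  apply: (segment_upper (g := g)) => //.
  + by move=> t t01; apply: cod; exact: ball_segment.
  + move=> t t01; have xt := ball_segment xa ya t01.
    have := bnd _ (y - x) (y - x) xt; set v := y - x => H.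
    apply: le_trans (ler_norm _) _; apply: le_trans H _.
    rewrite -mulrA -expr2 exprMn; apply: ler_wpM2r; first exact: sqr_ge0.
    by rewrite /Kp; nra.
  + by rewrite mulr_ge0// ltW.
have [rho0 rho00 Hz] : exists2 rho0 : R, 0 < rho0 & forall z,
    mdist p0 z < 2 * rho0 -> chart_dom (atlas i) z /\ `|psi z - a| < r2.
  have : \forall z \near p0, chart_dom (atlas i) z /\ `|psi z - a| < r2.
    near=> z; split.
      by near: z; apply: open_nbhs_nbhs; split => //; exact: chart_dom_open.
    near: z; have /cvgrPdist_lt/(_ _ r20) := chart_fun_cvg pi.
    by apply: filterS => z; rewrite distrC.
  move=> /nbhs_ballP[e /= e0 He]; exists (e / 2); first by rewrite divr_gt0.
  by move=> z pz; apply: He; rewrite ballEmdist /=; lra.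
have low p q : mdist p0 p + mdist p q < 2 * rho0 ->
    lam * `|psi q - psi p| <= mdist p q.
  move=> pq; apply: (dist_coord_lower hdist _ _ _ pq) => //.
  by move=> z /Hz[zi za]; split => // u; exact: coer.
pose r := Num.min r2 (rho0 / (4 * Kp)).
have Kp4 : 0 < 4 * Kp by lra.
have r0 : 0 < r by rewrite lt_min r20 divr_gt0.
have rr2 x : `|x - a| < r -> `|x - a| < r2 by rewrite lt_min => /andP[].
have rK x : `|x - a| < r -> Kp * `|x - a| < rho0 / 4.
  by rewrite lt_min => /andP[_]; rewrite ltr_pdivlMr// => H; lra.
have aa : `|a - a| < r2 by rewrite subrr normr0.
have Pa : P a = p0 by exact: chart_funK.
have near_p0 x : `|x - a| < r -> mdist p0 (P x) < rho0 / 4.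
  move=> xa; rewrite -Pa; apply: le_lt_trans (rK _ xa).
  by apply: dist_up => //; exact: rr2.
have near_xy x y : `|x - a| < r -> `|y - a| < r ->
    mdist (P x) (P y) < rho0 / 2.
  move=> /near_p0 xa /near_p0 ya.
  have := metric_triangle (P x) p0 (P y); rewrite (metric_sym (P x) p0); lra.
have psiK x : `|x - a| < r -> psi (P x) = x.
  by move=> xa; apply: chart_invK; exact/cod/rr2.
(* at distance D from x, the metric is at least (1 - c D) times that at x *)
pose c := L / lam ^+ 2.
have c0 : 0 <= c by rewrite divr_ge0// sqr_ge0.
have dist2_low x y : `|x - a| < r -> `|y - a| < r ->
    (1 - c * mdist (P x) (P y)) * bform (Q x) (y - x) (y - x) <=
    mdist (P x) (P y) ^+ 2.
  move=> xa ya; set D := mdist _ _; set N := bform _ _ _.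
  have D0 : 0 <= D by exact: mdist_ge0.
  have N0 : 0 <= N.
    exact: le_trans (mulr_ge0 (ltW lam0) (sqr_ge0 _)) (coer _ _ (rr2 _ xa)).
  have eta_bound (eta : R) : 0 < eta -> eta <= rho0 ->
      (1 - c * (D + eta)) * N <= (D + eta) ^+ 2.
    move=> eta0 etar; apply: (dist_sq_lower hdist (q := P y)).
    - exact/cod/rr2.
    - by rewrite -/psi psiK.
    - by rewrite -/P -/D; lra.
    - move=> z pz; have nx := near_p0 _ xa; have nxy := near_xy _ _ xa ya.
      have [zi za] : chart_dom (atlas i) z /\ `|psi z - a| < r2.
        apply: Hz; have := metric_triangle p0 (P x) z.
        by move: pz nxy; rewrite -/P -/D; lra.
      split=> // u.
      have lz : lam * `|psi z - x| <= D + eta.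
        rewrite -{1}(psiK _ xa); apply: le_trans (low _ _ _) (ltW pz).
        by move: pz nxy; rewrite -/P -/D; lra.
      have H1 := lip _ _ u u (rr2 _ xa) za.
      have H2 := coer _ u (rr2 _ xa).
      have := ler_norm (bform (Q x) u u - bform (Q (psi z)) u u).
      move: H1 H2; rewrite /gnorm2 -/(Q _) -/(Q _).
      set bx := bform (Q x) u u; set bz := bform (Q (psi z)) u u.
      move=> H1 H2 H3.
      suff H4 : L * `|psi z - x| * `|u| * `|u| <= c * (D + eta) * bx by lra.
      rewrite /c -[_ * `|u| * `|u|]mulrA -expr2 -!mulrA; apply: ler_wpM2l => //.
      rewrite ler_pdivlMl ?exprn_gt0//.
      have -> : lam ^+ 2 * (`|psi z - x| * `|u| ^+ 2) =
        (lam * `|psi z - x|) * (lam * `|u| ^+ 2) by ring.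
      by apply: ler_pM => //; rewrite mulr_ge0 ?sqr_ge0// ltW.
  apply/ler_addgt0Pr => e e0.
  pose B := 2 * D + 1 + c * N.
  have B0 : 0 < B.
    by rewrite /B; have := mulr_ge0 c0 N0; lra.
  pose eta := Num.min (e / B) (Num.min 1 rho0).
  have eta0 : 0 < eta by rewrite !lt_min divr_gt0//= ltr01.
  have := eta_bound eta eta0.
  have eB : eta * B <= e by rewrite -ler_pdivlMr// ge_min lexx.
  have e1 : eta <= 1 by rewrite !ge_min lexx orbT.
  have er : eta <= rho0 by rewrite !ge_min lexx !orbT.
  move=> /(_ er) H.
  have ee : eta ^+ 2 <= eta by rewrite expr2 -[leRHS]mulr1 ler_pM2l.
  move: eB H; rewrite /B; nra.
pose Lam := Kp + L + c * Kp ^+ 3.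
have ck0 : 0 <= c * Kp ^+ 3 by rewrite mulr_ge0// exprn_ge0// ltW.
pose rho := Num.min rho0 (lam * r / 2).
exists P, psi, Q, r, rho, lam, Lam; split => //.
- by rewrite lt_min rho00 divr_gt0// mulr_gt0.
- by rewrite /Lam; lra.
- move=> z; rewrite lt_min => /andP[zr zl].
  have [zi za] : chart_dom (atlas i) z /\ `|psi z - a| < r2.
    by apply: Hz; lra.
  split; last exact: chart_funK.
  rewrite -(ltr_pM2l lam0) mulrA; apply: le_lt_trans zl.
  by apply: low; rewrite mdistxx; lra.
- move=> x y xa ya; rewrite -{1}(psiK _ xa) -{1}(psiK _ ya); apply: low.
  have := near_p0 _ xa; have := near_xy _ _ xa ya; lra.
- move=> x y xa ya; apply: le_trans (dist_up _ _ (rr2 _ xa) (rr2 _ ya)) _.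
  by apply: ler_wpM2r => //; rewrite /Lam; lra.
- by move=> x /rr2 /cod; exact: Defs.metric_sym.
- by move=> x u /rr2 xa; exact: coer.
- move=> x u v /rr2 xa; apply: le_trans (bnd _ _ _ xa) _.
  have KKp : K <= Kp by rewrite /Kp; lra.
  by do 2!apply: ler_wpM2r => //; rewrite /Lam; lra.
- move=> x y u v /rr2 xa /rr2 ya; apply: le_trans (lip _ _ _ _ xa ya) _.
  by do 3!apply: ler_wpM2r => //; rewrite /Lam; lra.
- move=> x y xa ya.
  have H1 := dist2_up _ _ (rr2 _ xa) (rr2 _ ya).
  have H2 := dist2_low _ _ xa ya.
  have H3 := dist_up _ _ (rr2 _ xa) (rr2 _ ya).
  have H4 := bnd _ (y - x) (y - x) (rr2 _ xa).
  move: H1 H2 H3 H4; rewrite -/Q -/(Q x).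
  have D0 : 0 <= mdist (P x) (P y) by exact: mdist_ge0.
  move: (mdist _ _) D0 (bform _ _ _) (`|y - x|) (normr_ge0 (y - x)).
  move=> D D0 N n n0 H1 H2 H3 H4.
  have H5 : N <= Kp * n ^+ 2.
    apply: le_trans (ler_norm _) _; apply: le_trans H4 _.
    by rewrite -mulrA -expr2; apply: ler_wpM2r; [exact: sqr_ge0|rewrite /Kp; lra].
  have H6 : c * D * N <= c * Kp ^+ 3 * n ^+ 3.
    have -> : c * Kp ^+ 3 * n ^+ 3 = c * (Kp * n) * (Kp * Kp * n ^+ 2) by ring.
    have [N0|N0] := leP 0 N; last first.
      apply: (@le_trans _ _ 0).
        by rewrite nmulr_lle0// mulr_ge0.
      by have Kp1 := ltW Kp0; do !apply: mulr_ge0 => //; exact: sqr_ge0.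
    apply: ler_pM => //; first by rewrite mulr_ge0.
      by apply: ler_wpM2l.
    apply: le_trans H5 _; apply: ler_wpM2r; first exact: sqr_ge0.
    rewrite /Kp; nra.
  have n3 : 0 <= n ^+ 3 by rewrite exprn_ge0.
  rewrite ler_norml; apply/andP; split.
    have : - ((L + Kp) * n ^+ 3) <= 0 by rewrite oppr_le0 mulr_ge0// addr_ge0// ltW.
    by rewrite /Lam; lra.
  have : 0 <= (Kp + c * Kp ^+ 3) * n ^+ 3 by rewrite mulr_ge0// addr_ge0// ltW.
  by rewrite /Lam; lra.
Unshelve. all: by end_near. Qed.

End ExistsLocalModel.

(** * Semiconcavity of the distance function *)

Lemma bform_sqrB {R : realType} {d : nat} (Q : 'M[R]_d) u y (q : R) : Q^T = Q ->
  bform Q (u - q *: y) (u - q *: y) =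
    bform Q u u - 2 * q * bform Q u y + q ^+ 2 * bform Q y y.
Proof.
move=> Qs.
rewrite -scaleNr !(bformDl, bformDr, bformZl, bformZr) (bform_sym y u Qs); ring.
Qed.

Lemma bform_sum {R : realType} {d : nat} (Q : 'M[R]_d) u y :
  bform Q u y = \sum_k bform Q u (delta_mx 0 k) * y 0 k.
Proof.
rewrite /bform mxE; apply: eq_bigr => k _.
by rewrite [y^T k 0]mxE trmx_delta -colE [col k _ 0 0]mxE.
Qed.

Section Superdifferential.
Context {R : realType} {d : nat} {M : metricType R}.
Hypothesis walk : forall (p q : M) (s e : R), 0 <= s -> s <= mdist p q -> 0 < e ->
  exists2 z, mdist p z = s & mdist z q <= mdist p q - s + e.

(** The discrete substitute for a geodesic from p to o: steps of exact length h,
   each of which wastes at most eta. *)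
Lemma walk_chain (p o : M) (h eta : R) (n : nat) : 0 <= h -> 0 < eta ->
  n%:R * h <= mdist p o ->
  exists z : nat -> M, [/\ z 0%N = p,
    forall k, (k < n)%N -> mdist (z k) (z k.+1) = h,
    forall k, (k <= n)%N -> mdist p (z k) <= k%:R * h &
    forall k, (k <= n)%N -> mdist (z k) o <= mdist p o - k%:R * h + k%:R * eta].
Proof.
move=> h0 eta0; elim: n => [|n IH] nh.
  exists (fun=> p); split => //.
  - by move=> k _; rewrite mdistxx mulr_ge0.
  - move=> k; rewrite leqn0 => /eqP ->; lra.
have [|z [z0 zs zp zo]] := IH.
  by apply: le_trans nh; rewrite ler_wpM2r// ler_nat.
have hz : h <= mdist (z n) o.
  have := metric_triangle p (z n) o; have := zp n (leqnn n).
  by move: nh; rewrite -natr1 mulrDl mul1r; lra.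
have [w zw wo] := walk h0 hz eta0.
exists (fun k => if (k <= n)%N then z k else w); split => //.
- move=> k; rewrite ltnS => kn; rewrite kn; case: ltnP => [kn'|nk].
    by apply: zs.
  by have -> : k = n by apply/eqP; rewrite eqn_leq kn nk.
- move=> k kn; case: leqP => [kn'|nk]; first exact: zp.
  have -> : k = n.+1 by apply/eqP; rewrite eqn_leq kn nk.
  have := metric_triangle p (z n) w; have := zp n (leqnn n).
  by rewrite -natr1 mulrDl mul1r; lra.
- move=> k kn; case: leqP => [kn'|nk]; first exact: zo.
  have -> : k = n.+1 by apply/eqP; rewrite eqn_leq kn nk.
  have := zo n (leqnn n).
  by rewrite -natr1 !mulrDl !mul1r; lra.
Qed.

Context {p0 : M} {P : 'rV[R]_d -> M} {psi : M -> 'rV[R]_d}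
  {Q : 'rV[R]_d -> 'M[R]_d} {r rho lam Lam : R}.
Hypothesis mod0 : local_model p0 P psi Q r rho lam Lam.

(** c2 * h bounds the coordinate size of a step of length h and of its
   deformation; A and B are the constants of the resulting error terms. *)
Let c2 : R := lam^-1 + 1.
Let A : R := 2 * Lam * c2 ^+ 3.
Let B (t0 delta : R) : R := 3 * Lam * c2 ^+ 2 + Lam * t0 / delta ^+ 2.

(** The first variation formula for one step of a discrete geodesic.  Moving the
   ends x, x1 of the step by s y and (s - h / delta) y changes the step vector u
   into u - (h / delta) y.  Expanding the square of the new length in the
   quadratic form at x, then comparing this form with the one at x0, gives
     h ^ 2 - 2 (h / delta) <u, y>_x0 + h ^ 2 O(h + |y|)
   for a fixed delta, and D <= (D ^ 2 + h ^ 2) / (2 h) turns it into a bound on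
   the length D. *)
Lemma deformed_step (x0 x x1 y : 'rV[R]_d) (h delta t0 s : R) :
  `|x0 - psi p0| < r -> `|x - psi p0| < r -> `|x1 - psi p0| < r ->
  `|x + s *: y - psi p0| < r -> `|x1 + (s - h / delta) *: y - psi p0| < r ->
  0 <= s <= 1 -> mdist (P x) (P x1) = h -> 0 < h -> h <= delta ->
  `|x - x0| <= delta / lam -> `|y| <= t0 -> t0 <= delta ->
  mdist (P (x + s *: y)) (P (x1 + (s - h / delta) *: y)) <=
    h + h / 2 * (A * h + B t0 delta * `|y|) - bform (Q x0) (x1 - x) y / delta.
Proof.
move=> x0a xa x1a xya x1ya /andP[s0 s1] xx1 h0 hd xx0 yt td.
have lam0 := lm_lam mod0; have Lam0 := lm_Lam mod0.
have d0 : 0 < delta by exact: lt_le_trans hd.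
set D' := mdist _ _; set q := h / delta.
have q0 : 0 < q by rewrite divr_gt0.
have c20 : 0 < c2 by rewrite addr_gt0// invr_gt0.
have t00 : 0 <= t0 by exact: le_trans yt.
set u := x1 - x.
have u'E : x1 + (s - q) *: y - (x + s *: y) = u - q *: y.
  by rewrite /u scalerBl; apply/rowP => k; rewrite !mxE; ring.
have H1 := lm_square mod0 xya x1ya.
rewrite u'E -/D' in H1.
have H2 := lm_lipschitz mod0 (u - q *: y) (u - q *: y) xa xya.
rewrite [x + _ - x]addrC addKr normrZ (ger0_norm s0) in H2.
have H3 : bform (Q x) (u - q *: y) (u - q *: y) =
    bform (Q x) u u - 2 * q * bform (Q x) u y + q ^+ 2 * bform (Q x) y y.
  exact: bform_sqrB (lm_sym mod0 xa).
have H4 := lm_square mod0 xa x1a; rewrite xx1 -/u in H4.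
have H5 := lm_lipschitz mod0 u y xa x0a; rewrite (distrC x0) in H5.
have H6 := lm_bounded mod0 y y xa.
have H7 := lm_lower mod0 xa x1a; rewrite xx1 -/u in H7.
have U' : `|u - q *: y| <= `|u| + q * `|y|.
  by apply: le_trans (ler_normB _ _) _; rewrite normrZ gtr0_norm.
have D'0 : 0 <= D' by exact: mdist_ge0.
have n0 := normr_ge0 (x - x0).
move: (`|u - q *: y|) U' (normr_ge0 (u - q *: y)) H1 H2 => U' HU' U'0 H1 H2.
move: (`|u|) HU' (normr_ge0 u) H4 H5 H7 => U HU' U0 H4 H5 H7.
move: (`|y|) yt HU' (normr_ge0 y) H2 H5 H6 => tau yt HU' tau0 H2 H5 H6.
move: (`|x - x0|) n0 xx0 H5 => w w0 xx0 H5.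
have Uh : U <= h / lam by rewrite ler_pdivlMr// mulrC.
have Uc : U <= c2 * h by rewrite /c2 mulrDl mul1r mulrC; move: Uh; lra.
have qt : q * tau <= h.
  rewrite /q mulrAC ler_pdivrMr//; apply: ler_wpM2l; lra.
have U'c : U' <= c2 * h by rewrite /c2 mulrDl mul1r mulrC; move: Uh; lra.
have wc : w <= c2 * delta.
  by rewrite /c2 mulrDl mul1r mulrC; lra.
have ch0 : 0 <= c2 * h by rewrite mulr_ge0// ltW.
have I1 : Lam * U' ^+ 3 <= Lam * c2 ^+ 3 * h ^+ 3.
  by rewrite -mulrA -exprMn; apply: ler_wpM2l; [lra|rewrite lerXn2r].
have I2 : Lam * U ^+ 3 <= Lam * c2 ^+ 3 * h ^+ 3.
  by rewrite -mulrA -exprMn; apply: ler_wpM2l; [lra|rewrite lerXn2r].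
have I3 : Lam * (s * tau) * U' * U' <= Lam * c2 ^+ 2 * h ^+ 2 * tau.
  have -> : Lam * c2 ^+ 2 * h ^+ 2 * tau = Lam * (1 * tau) * (c2 * h) * (c2 * h) by ring.
  apply: ler_pM => //; rewrite ?mulr_ge0//; try exact: ltW.
  apply: ler_pM => //; rewrite ?mulr_ge0//; try exact: ltW.
  by apply: ler_wpM2l; [exact: ltW|exact: ler_wpM2r].
have I4 : q * (Lam * w * U * tau) <= Lam * c2 ^+ 2 * h ^+ 2 * tau.
  have -> : Lam * c2 ^+ 2 * h ^+ 2 * tau = q * (Lam * (c2 * delta) * (c2 * h) * tau).
    by rewrite /q; field; rewrite gt_eqF.
  apply: ler_wpM2l; first exact: ltW.
  apply: ler_wpM2r => //; apply: ler_pM => //; first by rewrite mulr_ge0// ltW.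
  by apply: ler_wpM2l => //; exact: ltW.
have I5 : q ^+ 2 * (Lam * tau * tau) <= Lam * t0 / delta ^+ 2 * tau * h ^+ 2.
  have -> : Lam * t0 / delta ^+ 2 * tau * h ^+ 2 = q ^+ 2 * (Lam * t0 * tau).
    by rewrite /q; field; rewrite gt_eqF.
  apply: ler_wpM2l; first exact: sqr_ge0.
  by apply: ler_wpM2r => //; apply: ler_wpM2l => //; exact: ltW.
have J4 : bform (Q x) u u <= h ^+ 2 + Lam * U ^+ 3.
  by move: H4; rewrite distrC ler_norml => /andP[_]; lra.
have J5 : - (q * bform (Q x) u y) <= - (q * bform (Q x0) u y) + q * (Lam * w * U * tau).
  rewrite -!mulrN -mulrDr; apply: ler_wpM2l; first exact: ltW.
  by move: H5; rewrite ler_norml => /andP[]; lra.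
have J6 : q ^+ 2 * bform (Q x) y y <= q ^+ 2 * (Lam * tau * tau).
  apply: ler_wpM2l; first exact: sqr_ge0.
  exact: le_trans (ler_norm _) H6.
have J1 : D' ^+ 2 <= bform (Q (x + s *: y)) (u - q *: y) (u - q *: y) + Lam * U' ^+ 3.
  by move: H1; rewrite ler_norml => /andP[_]; lra.
have J2 : bform (Q (x + s *: y)) (u - q *: y) (u - q *: y) <=
    bform (Q x) (u - q *: y) (u - q *: y) + Lam * (s * tau) * U' * U'.
  by move: H2; rewrite ler_norml => /andP[]; lra.
have key : D' ^+ 2 <= h ^+ 2 + h ^+ 2 * (A * h + B t0 delta * tau)
    - 2 * (q * bform (Q x0) u y).
  have -> : h ^+ 2 * (A * h + B t0 delta * tau) = 2 * (Lam * c2 ^+ 3 * h ^+ 3)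
     + 3 * (Lam * c2 ^+ 2 * h ^+ 2 * tau) + Lam * t0 / delta ^+ 2 * tau * h ^+ 2.
    by rewrite /A /B; ring.
  by move: J2; rewrite H3; lra.
rewrite -(ler_pM2l (_ : 0 < 2 * h)); last by lra.
have -> : 2 * h * (h + h / 2 * (A * h + B t0 delta * tau) - bform (Q x0) u y / delta)
  = h ^+ 2 + (h ^+ 2 + h ^+ 2 * (A * h + B t0 delta * tau) - 2 * (q * bform (Q x0) u y)).
  by rewrite /q; field; rewrite gt_eqF.
have := sqr_ge0 (D' - h); rewrite sqrrB; lra.
Qed.

(** Semiconcavity of the distance to o at p, up to an arbitrarily small error e.
   Take a discrete geodesic of length delta from p towards o and displace its
   k-th point by (1 - k / n) y: it now joins p + y to the same end point, and the
   first variations of its n steps add up to - <v, y> / delta, where v is the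
   vector from p to the end of the chain.  The quadratic errors add up to
   O(delta + t0 / delta) |y|, which is made smaller than kappa |y| by the choice
   of delta, then of t0; the errors due to the size of the steps vanish as n
   grows.  The form l = <v, .> / delta is bounded away from 0 because the chain
   moves by about delta in the direction v.  All constants are independent of
   o, of p and of the distance between them. *)
Lemma superdifferential :
  exists c0 C1 : R, [/\ 0 < c0, 0 < C1 & forall kappa, 0 < kappa ->
    exists2 t0 : R, 0 < t0 & forall (o p : M) (e : R), 0 < e ->
      mdist p0 p < rho / 2 -> 1 <= mdist p o ->
      exists l : 'rV[R]_d, [/\ c0 <= `|l|, `|l| <= C1 &
        forall y, `|y| <= t0 -> mdist (P (psi p + y)) o <=
          mdist p o - \sum_k l 0 k * y 0 k + kappa * `|y| + e]].
Proof.
have lam0 := lm_lam mod0; have Lam0 := lm_Lam mod0.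
have r0 := lm_r mod0; have rho0 := lm_rho mod0.
have c20 : 0 < c2 by rewrite addr_gt0// invr_gt0.
exists (lam / (2 * Lam * d.+1%:R)), (Lam / lam); split.
- by rewrite divr_gt0// !mulr_gt0.
- by rewrite divr_gt0.
move=> kappa kappa0.
pose delta := Num.min 1 (Num.min (rho / 4) (kappa / (3 * Lam * c2 ^+ 2))).
have D0 : 0 < 3 * Lam * c2 ^+ 2 by rewrite !mulr_gt0.
have delta0 : 0 < delta by rewrite !lt_min ltr01 !divr_gt0.
have delta1 : delta <= 1 by rewrite ge_min lexx.
have deltar : delta <= rho / 4 by rewrite !ge_min lexx orbT.
have deltak : 3 * Lam * c2 ^+ 2 * delta <= kappa.
  by rewrite mulrC -ler_pdivlMr// !ge_min lexx !orbT.
clearbody delta.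
pose t0 := Num.min delta (Num.min (r / 2) (kappa * delta / Lam)).
have t00 : 0 < t0 by rewrite !lt_min delta0 !divr_gt0// mulr_gt0.
have t0d : t0 <= delta by rewrite ge_min lexx.
have t0r : t0 <= r / 2 by rewrite !ge_min lexx orbT.
have t0k : Lam * t0 / delta <= kappa.
  by rewrite ler_pdivrMr// mulrC -ler_pdivlMr// !ge_min lexx !orbT.
clearbody t0; exists t0 => // o p e e0 pp0 po.
have A0 : 0 < A by rewrite /A !mulr_gt0// exprn_gt0.
pose n := (Num.Def.archi_bound (delta ^+ 2 * A / e)).+1.
have n0 : 0 < n%:R :> R by rewrite ltr0n.
have nn0 : n%:R != 0 :> R by rewrite gt_eqF.
have ne : delta ^+ 2 * A / n%:R <= e.
  rewrite ler_pdivrMr// [e * _]mulrC -ler_pdivrMr//.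
  have X0 : 0 <= delta ^+ 2 * A / e.
    by rewrite divr_ge0 ?(ltW e0)// mulr_ge0 ?sqr_ge0// ltW.
  apply: le_trans (ltW (archi_boundP X0)) _.
  by rewrite ler_nat /n.
pose h := delta / n%:R.
have h0 : 0 < h by rewrite divr_gt0.
have nh : n%:R * h = delta by rewrite /h mulrC divfK.
have hd : h <= delta.
  by rewrite -nh -[leLHS]mul1r ler_pM2r// ler1n.
pose eta := Num.min (e / 2) (delta / 2) / n%:R.
have eta0 : 0 < eta by rewrite divr_gt0// lt_min !divr_gt0.
have neta : n%:R * eta = Num.min (e / 2) (delta / 2) by rewrite mulrC divfK.
have netae : n%:R * eta <= e / 2 by rewrite neta ge_min lexx.
have netad : n%:R * eta <= delta / 2 by rewrite neta ge_min lexx orbT.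
clearbody eta.
have [|z [z0 zs zp zo]] := walk_chain (p := p) (o := o) (n := n) (ltW h0) eta0.
  by rewrite nh; exact: le_trans po.
have kh k : (k <= n)%N -> k%:R * h <= delta.
  by move=> kn; rewrite -nh ler_wpM2r ?ler_nat// ltW.
pose x k := psi (z k).
have zin k : (k <= n)%N -> mdist p0 (z k) < rho.
  move=> kn; have := metric_triangle p0 p (z k); have := zp _ kn; have := kh _ kn.
  lra.
have xa k : (k <= n)%N -> `|x k - psi p0| < r / 2.
  by move=> /zin /(lm_coord mod0)[].
have Px k : (k <= n)%N -> P (x k) = z k.
  by move=> /zin /(lm_coord mod0)[].
have xr k : (k <= n)%N -> `|x k - psi p0| < r.
  by move=> /xa; lra.
have x0d k : (k <= n)%N -> `|x k - x 0%N| <= delta / lam.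
  move=> kn; rewrite ler_pdivlMr// mulrC.
  apply: le_trans (lm_lower mod0 (xr 0%N isT) (xr _ kn)) _.
  by rewrite !Px// z0; apply: le_trans (zp _ kn) (kh _ kn).
set v := x n - x 0%N.
pose l : 'rV[R]_d := \row_k (bform (Q (x 0%N)) v (delta_mx 0 k) / delta).
have lE (y : 'rV[R]_d) : \sum_k l 0 k * y 0 k = bform (Q (x 0%N)) v y / delta.
  rewrite bform_sum mulr_suml; apply: eq_bigr => k _.
  by rewrite mxE mulrAC.
have zn : mdist (z n) o <= mdist p o - delta + n%:R * eta.
  by have := zo _ (leqnn n); rewrite nh.
exists l; split.
(* the chain gets closer to o by at least delta / 2 *)
- have vlow : delta / 2 <= Lam * `|v|.
    have := lm_upper mod0 (xr 0%N isT) (xr _ (leqnn n)).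
    rewrite !Px// z0 -/v; have := metric_triangle p (z n) o; lra.
  have v0 : 0 < `|v|.
    by rewrite -(pmulr_rgt0 _ Lam0); apply: lt_le_trans vlow; rewrite divr_gt0.
  have H1 := lm_coercive mod0 v (xr 0%N isT).
  have H2 : bform (Q (x 0%N)) v v / delta <= d.+1%:R * `|l| * `|v|.
    rewrite -lE; apply: le_trans (ler_norm _) _.
    apply: le_trans (ler_norm_sum _ _ _) _.
    apply: (@le_trans _ _ (\sum_(k < d) `|l| * `|v|)).
      by apply: ler_sum => k _; rewrite normrM; apply: ler_pM => //; exact: mx_entry_le.
    rewrite sumr_const card_ord -[leLHS]mulr_natl mulrA.
    by do 2!apply: ler_wpM2r => //; rewrite ler_nat.
  rewrite ler_pdivrMr; last by rewrite !mulr_gt0.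
  rewrite ler_pdivrMr// in H2.
  have H3 : lam * `|v| <= d.+1%:R * `|l| * delta.
    rewrite -(ler_pM2r v0); apply: le_trans (_ : lam * `|v| ^+ 2 <= _).
      by rewrite expr2 mulrA.
    by apply: le_trans H1 (le_trans H2 _); rewrite mulrAC.
  have H4 : lam * (delta / 2) <= Lam * (d.+1%:R * `|l| * delta).
    apply: (@le_trans _ _ (lam * (Lam * `|v|))); first by rewrite ler_pM2l.
    by rewrite mulrCA ler_pM2l.
  rewrite -(ler_pM2r delta0); move: H4; lra.
- apply: mx_norm_le; first by rewrite divr_ge0// ltW.
  move=> i k; rewrite mxE normrM normfV (gtr0_norm delta0) ler_pdivrMr//.
  apply: le_trans (lm_bounded mod0 _ _ (xr 0%N isT)) _.
  have e1 : `|delta_mx 0 k : 'rV[R]_d| <= 1.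
    apply: mx_norm_le => // i' j; rewrite mxE; case: andP => _.
      by rewrite normr1.
    by rewrite normr0.
  apply: (@le_trans _ _ (Lam * `|v| * 1)).
    by apply: ler_wpM2l => //; rewrite mulr_ge0// ltW.
  rewrite mulr1 -mulrA ler_pM2l// mulrC; exact: x0d.
move=> y yt0.
pose s k : R := 1 - k%:R * h / delta.
have sE k : s k.+1 = s k - h / delta by rewrite /s -natr1; lra.
have s01 k : (k <= n)%N -> 0 <= s k <= 1.
  move=> kn; rewrite /s subr_ge0 ler_pdivrMr// mul1r kh//= gerBl.
  by rewrite divr_ge0 ?mulr_ge0// ltW.
have ya k : (k <= n)%N -> `|x k + s k *: y - psi p0| < r.
  move=> kn; rewrite addrAC; apply: le_lt_trans (ler_normD _ _) _.
  rewrite normrZ; have /andP[s0 s1] := s01 _ kn; rewrite ger0_norm//.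
  have := xa _ kn; have : s k * `|y| <= 1 * t0 by apply: ler_pM.
  lra.
set Bt := B t0 delta.
have step k : (k <= n)%N ->
    mdist (P (x 0%N + s 0%N *: y)) (P (x k + s k *: y)) <=
    k%:R * (h + h / 2 * (A * h + Bt * `|y|)) - bform (Q (x 0%N)) (x k - x 0%N) y / delta.
  elim: k => [_|k IH kn].
    by rewrite mdistxx mul0r subrr bform0l mul0r subr0.
  have kn' := ltnW kn.
  have H := @deformed_step (x 0%N) (x k) (x k.+1) y h delta t0 (s k).
  rewrite -sE in H.
  have {}H := H (xr 0%N isT) (xr _ kn') (xr _ kn) (ya _ kn') (ya _ kn) (s01 _ kn').
  rewrite !Px// in H.
  have {}H := H (zs _ kn) h0 hd (x0d _ kn') yt0 t0d.
  have := metric_triangle (P (x 0%N + s 0%N *: y)) (P (x k + s k *: y))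
    (P (x k.+1 + s k.+1 *: y)).
  have -> : x k.+1 - x 0%N = (x k.+1 - x k) + (x k - x 0%N) by rewrite addrA subrK.
  rewrite bformDl -natr1; move: (IH kn') H; rewrite -/Bt.
  move: (mdist _ _) (mdist _ _) (mdist _ _) => m1 m2 m3.
  move: (bform _ _ _) (bform _ _ _) => b1 b2.
  move: (h + _) => X; rewrite !mulrDl mul1r; lra.
have := step _ (leqnn n).
have -> : s n = 0 by rewrite /s nh divff ?subrr// gt_eqF.
have -> : s 0%N = 1 by rewrite /s !mul0r subr0.
rewrite scale1r scale0r addr0 (Px _ (leqnn n)) -/v => H.
have := metric_triangle (P (x 0%N + y)) (z n) o.
rewrite {1 2}/x z0 lE.
move: H; rewrite {1}/x z0 => H.
have Btk : delta / 2 * (Bt * `|y|) <= kappa * `|y|.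
  rewrite mulrA; apply: ler_wpM2r => //.
  have -> : delta / 2 * Bt = 2^-1 * (3 * Lam * c2 ^+ 2 * delta + Lam * t0 / delta).
    by rewrite /Bt /B; field; rewrite gt_eqF.
  lra.
have Ahe : delta / 2 * (A * h) <= e / 2.
  have -> : delta / 2 * (A * h) = delta ^+ 2 * A / n%:R / 2.
    by rewrite /h; field.
  lra.
have E : n%:R * (h + h / 2 * (A * h + Bt * `|y|)) =
   delta + delta / 2 * (A * h) + delta / 2 * (Bt * `|y|).
  by rewrite -nh; field.
move: H; rewrite E; lra.
Qed.

End Superdifferential.

(** * Covering a piece of a sphere *)

Section Covering.
Context {R : realType} {M : metricType R}.

Lemma real_cells (B w : R) : 0 <= B -> 0 < w ->
  exists m (f : R -> 'I_m), m%:R <= 2 * B / w + 1 /\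
    forall x x', `|x| <= B -> `|x'| <= B -> f x = f x' -> `|x - x'| <= w.
Proof.
move=> B0 w0; pose m := Num.truncn (2 * B / w).
have Bw0 : 0 <= 2 * B / w by rewrite divr_ge0 ?mulr_ge0// ltW.
pose f (x : R) : 'I_m.+1 := inord (Num.truncn ((x + B) / w)).
exists m.+1, f; split.
  by rewrite -natr1 lerD2r; have /andP[] := truncn_itv Bw0.
have fx x : `|x| <= B -> (f x)%:R * w <= x + B < ((f x)%:R + 1) * w.
  rewrite ler_norml => /andP[xB Bx].
  have xw0 : 0 <= (x + B) / w by rewrite divr_ge0 ?(ltW w0)//; lra.
  have /andP[t1 t2] := truncn_itv xw0.
  rewrite /f inordK; last first.
    rewrite ltnS; apply: le_truncn.
    by rewrite ler_pM2r ?invr_gt0//; lra.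
  by rewrite -ler_pdivlMr// t1 -ltr_pdivrMr// natr1.
move=> x x' /fx /andP[x1 x2] /fx /andP[x'1 x'2] E; rewrite E in x1 x2.
rewrite ler_norml; apply/andP; split; lra.
Qed.

(** One centre is chosen in each non-empty class. *)
Lemma cover_by_classes (T : finType) (F : M -> T) (A : set M) (e : R) :
  (forall p p', A p -> A p' -> F p = F p' -> mdist p p' < e) ->
  exists2 s : seq M, (size s <= #|T|)%N &
    forall p, A p -> exists2 c, c \in s & mdist c p < e.
Proof.
move=> AF.
pose rep (t : T) : option M :=
  if pselect (exists p, A p /\ F p = t) is left H then Some (projT1 (cid H))
  else None.
exists (pmap rep (enum T)).
  by rewrite size_pmap (leq_trans (count_size _ _))// -cardE.
move=> p Ap; case E : (rep (F p)) => [c|]; last first.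
  by move: E; rewrite /rep; case: pselect => // H; case: H; exists p.
have [Ac Fc] : A c /\ F c = F p.
  move: E; rewrite /rep; case: pselect => // H [<-].
  by case: cid.
exists c; last exact: AF.
rewrite mem_pmap; apply/mapP; exists (F p); rewrite ?mem_enum//.
Qed.

End Covering.

Section LocalCover.
Context {R : realType} {d : nat} {M : metricType R}.
Hypothesis walk : forall (p q : M) (s e : R), 0 <= s -> s <= mdist p q -> 0 < e ->
  exists2 z, mdist p z = s & mdist z q <= mdist p q - s + e.
Context {p0 : M} {P : 'rV[R]_d.+1 -> M} {psi : M -> 'rV[R]_d.+1}
  {Q : 'rV[R]_d.+1 -> 'M[R]_d.+1} {r rho lam Lam : R}.
Hypothesis mod0 : local_model p0 P psi Q r rho lam Lam.

(** The Lipschitz graph estimate: the k-th coefficient of l is at least c0, so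
   the equation l y = O(b) + (c0 / 2) |y| can be solved for the k-th coordinate
   of y in terms of the other ones. *)
Lemma graph_bound (l y : 'rV[R]_d.+1) (k : 'I_d.+1) (c0 C1 b : R) :
  0 < c0 -> 0 <= C1 -> 0 <= b -> c0 <= `|l 0 k| -> `|l| <= C1 ->
  (forall j, `|y 0 (lift k j)| <= b) ->
  `|\sum_i l 0 i * y 0 i| <= c0 / 2 * `|y| + b ->
  `|y| <= (1 + 2 / c0 * (1 + d%:R * C1 + c0 / 2)) * b.
Proof.
move=> c00 C10 b0 lk lC yb.
rewrite (bigD1_ord k)//=; set rest := \sum_(i < d) _ => H.
have restb : `|rest| <= d%:R * C1 * b.
  apply: le_trans (ler_norm_sum _ _ _) _.
  apply: (@le_trans _ _ (\sum_(i < d) C1 * b)).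
    apply: ler_sum => j _; rewrite normrM; apply: ler_pM => //.
    exact: le_trans (mx_entry_le _ _ _) lC.
  by rewrite sumr_const card_ord -[leLHS]mulr_natl mulrA.
have yk : `|y| <= `|y 0 k| + b.
  apply: mx_norm_le; first by rewrite addr_ge0.
  move=> i j; rewrite (ord1 i); case: (unliftP k j) => [j' ->|->].
    by apply: le_trans (yb j') _; rewrite lerDr.
  by rewrite lerDl.
have H1 : `|l 0 k| * `|y 0 k| <= c0 / 2 * `|y| + b + d%:R * C1 * b.
  rewrite -normrM.
  have := ler_normB (l 0 k * y 0 k + rest) rest; rewrite addrK; lra.
have H2 : c0 * `|y 0 k| <= `|l 0 k| * `|y 0 k| by apply: ler_wpM2r.
move: `|y| `|y 0 k| (normr_ge0 (y 0 k)) H H1 H2 yk => Y z z0 _ H1 H2 yk.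
have H3 : c0 / 2 * Y <= c0 / 2 * z + c0 / 2 * b.
  by rewrite -mulrDr; apply: ler_wpM2l => //; rewrite divr_ge0// ltW.
have H4 : z <= 2 / c0 * (1 + d%:R * C1 + c0 / 2) * b.
  rewrite -(ler_pM2l c00).
  have -> : c0 * (2 / c0 * (1 + d%:R * C1 + c0 / 2) * b) =
      2 * (b + d%:R * C1 * b + c0 / 2 * b) by field; rewrite gt_eqF.
  lra.
lra.
Qed.

(** Two points p, p' of a sphere centred at o are at the same distance from o.
   The superdifferential inequality at p, and at p', thus bounds the form l p by
   kappa |y| + b on y = psi p' - psi p, and bounds - l p' likewise; if the forms
   are close to each other, then |l p y| <= (c0 / 2) |y| + b.  Sort the points
   by an index k of a large coefficient of l p, by the cells of l p, whose
   number does not depend on the radius e of the balls, and by the cells of size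
   b, proportional to e, of the coordinates other than the k-th.  There are
   O(e ^ (-d)) classes, and by the graph estimate the points of one class are at
   distance less than e. *)
Lemma sphere_local_cover :
  exists s0 K : R, [/\ 0 < s0, 0 < K & forall e : R, 0 < e -> e <= 1 ->
    forall (o : M) (t : R), 1 <= t ->
    exists2 s : seq M, (size s)%:R <= K / e ^+ d &
      forall p, mdist p0 p < s0 -> mdist o p = t ->
        exists2 c, c \in s & mdist c p < e].
Proof.
have lam0 := lm_lam mod0; have Lam0 := lm_Lam mod0.
have r0 := lm_r mod0; have rho0 := lm_rho mod0.
have [c0 [C1 [c00 C10 Hsup]]] := superdifferential walk mod0.
have c04 : 0 < c0 / 4 by rewrite divr_gt0.
have [t0 t00 {}Hsup] := Hsup _ c04.
(* the constant of the graph estimate *)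
pose C3 := 1 + 2 / c0 * (1 + d%:R * C1 + c0 / 2).
have C30 : 0 < C3.
  rewrite addr_gt0// mulr_gt0 ?divr_gt0// ltr_wpDr ?divr_ge0 ?ltW// ltr_wpDr//.
  by rewrite mulr_ge0 ?ler0n// ltW.
have pa p : mdist p0 p < rho -> lam * `|psi p - psi p0| <= mdist p0 p.
  move=> pp; have [pr Pp] := lm_coord mod0 pp.
  have p0p0 : mdist p0 p0 < rho by rewrite mdistxx.
  have [p0r Pp0] := lm_coord mod0 p0p0.
  have := lm_lower mod0 (x := psi p0) (y := psi p).
  by rewrite Pp Pp0 subrr normr0; apply=> //; lra.
pose s0 := Num.min (rho / 2) (lam * (t0 / 2)).
have s00 : 0 < s0 by rewrite lt_min !divr_gt0//= mulr_gt0// divr_gt0.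
have s0rho p : mdist p0 p < s0 -> mdist p0 p < rho / 2.
  by rewrite lt_min => /andP[].
have s0t p : mdist p0 p < s0 -> `|psi p - psi p0| <= t0 / 2.
  move=> ps; have pr := s0rho _ ps; rewrite -(ler_pM2l lam0).
  apply: le_trans (pa _ _) _; first lra.
  by move: ps; rewrite lt_min => /andP[_] /ltW.
clearbody s0.
(* cells of this size change the value of a form on y by at most c0 / 4 |y| *)
pose w := c0 / (4 * d.+1%:R).
have w0 : 0 < w by rewrite divr_gt0// mulr_gt0.
have [m1 [f1 [_ Hf1]]] := real_cells (ltW C10) w0.
pose K2 := t0 * (2 * Lam * C3) + 1.
have K20 : 0 < K2 by rewrite addr_gt0// !mulr_gt0.
exists s0, (d.+1%:R * (m1 ^ d.+1)%:R * K2 ^+ d + 1); split => //.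
  by rewrite ltr_wpDl// !mulr_ge0// exprn_ge0// ltW.
move=> e e0 e1 o t t1.
(* by the graph estimate, classes then have diameter at most e / 2 *)
pose b := e / (2 * Lam * C3).
have b0 : 0 < b by rewrite divr_gt0// !mulr_gt0.
have t02 : 0 <= t0 / 2 by rewrite divr_ge0// ltW.
have [m2 [f2 [m2K Hf2]]] := real_cells t02 b0.
have {}m2K : m2%:R <= K2 / e.
  apply: le_trans m2K _.
  have -> : K2 / e = 2 * (t0 / 2) / b + e^-1.
    by rewrite /K2 /b; field; rewrite !gt_eqF.
  by rewrite lerD2l invf_ge1.
pose A := [set p | mdist p0 p < s0 /\ mdist o p = t].
pose good p (kl : 'I_d.+1 * 'rV[R]_d.+1) := [/\ c0 <= `|kl.2 0 kl.1|,
   `|kl.2| <= C1 & forall y, `|y| <= t0 -> mdist (P (psi p + y)) o <=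
          mdist p o - \sum_k kl.2 0 k * y 0 k + c0 / 4 * `|y| + b].
have exgood p : A p -> exists kl, good p kl.
  move=> [ps po]; have [l [lc lC ly]] := Hsup o p b b0 (s0rho _ ps)
    (eq_ind_r (fun z => 1 <= z) t1 (etrans (metric_sym p o) po)).
  have [k kc] : exists k, c0 <= `|l 0 k|.
    apply: contrapT => /forallNP H.
    have : `|l| < c0.
      rewrite [ltLHS]/Num.norm /= mx_normrE; apply: bigmax_lt => // -[i j] _ /=.
      by rewrite (ord1 i) ltNge; apply/negP; exact: H.
    by rewrite ltNge lc.
  by exists (k, l).
pose kl p := xget (ord0, 0) [set kl | good p kl].
have Hkl p : A p -> good p (kl p).
  by move=> /exgood[x xg]; exact: (xgetPex (ord0, 0) (ex_intro _ x xg)).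
clearbody kl.
pose F p : 'I_d.+1 * {ffun 'I_d.+1 -> 'I_m1} * {ffun 'I_d -> 'I_m2} :=
  ((kl p).1, [ffun j => f1 ((kl p).2 0 j)],
   [ffun j => f2 ((psi p - psi p0) 0 (lift (kl p).1 j))]).
have AF p p' : A p -> A p' -> F p = F p' -> mdist p p' < e.
  move=> Ap Ap' [Ek /ffunP E1 /ffunP E2].
  have [lk lC ly] := Hkl _ Ap; have [lk' lC' ly'] := Hkl _ Ap'.
  case: Ap => ps pt; case: Ap' => ps' pt'.
  set y := psi p' - psi p.
  have pr := s0rho _ ps; have pr' := s0rho _ ps'.
  have [|pa1 Pp] := lm_coord mod0 (z := p); first by lra.
  have [|pa1' Pp'] := lm_coord mod0 (z := p'); first by lra.
  have yt0 : `|y| <= t0.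
    have -> : y = (psi p' - psi p0) - (psi p - psi p0) by rewrite /y opprB addrA subrK.
    apply: le_trans (ler_normB _ _) _.
    by have := s0t _ ps; have := s0t _ ps'; lra.
  have l1 : \sum_k (kl p).2 0 k * y 0 k <= c0 / 4 * `|y| + b.
    have := ly _ yt0; rewrite /y [psi p + _]addrC subrK Pp'.
    by rewrite -/y !(metric_sym _ o) pt pt'; lra.
  have l2 : - (\sum_k (kl p').2 0 k * y 0 k) <= c0 / 4 * `|y| + b.
    have := ly' (- y); rewrite normrN => /(_ yt0).
    have -> : psi p' + - y = psi p by rewrite /y opprB addrC subrK.
    rewrite Pp !(metric_sym _ o) pt pt'.
    under eq_bigr do rewrite mxE mulrN.
    by rewrite sumrN; lra.
  have l3 : `|\sum_k (kl p).2 0 k * y 0 k - \sum_k (kl p').2 0 k * y 0 k|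
      <= c0 / 4 * `|y|.
    rewrite -sumrB; apply: le_trans (ler_norm_sum _ _ _) _.
    apply: (@le_trans _ _ (\sum_(k < d.+1) w * `|y|)).
      apply: ler_sum => k _; rewrite -mulrBl normrM; apply: ler_pM => //.
        apply: Hf1.
        - exact: le_trans (mx_entry_le _ _ _) lC.
        - exact: le_trans (mx_entry_le _ _ _) lC'.
        - by have := E1 k; rewrite !ffunE.
      exact: mx_entry_le.
    rewrite sumr_const card_ord -[leLHS]mulr_natl mulrA; apply: ler_wpM2r => //.
    rewrite le_eqVlt; apply/orP; left; apply/eqP; rewrite /w.
    have : d.+1%:R != 0 :> R by rewrite pnatr_eq0.
    by move: d.+1%:R => D D0; field.
  have yC : `|y| <= C3 * b.
    apply: (graph_bound c00 (ltW C10) (ltW b0) lk lC).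
      move=> j; have := E2 j; rewrite !ffunE -Ek => fE.
      have -> : y 0 (lift (kl p).1 j) = (psi p' - psi p0) 0 (lift (kl p).1 j) -
          (psi p - psi p0) 0 (lift (kl p).1 j).
        by rewrite /y !mxE; ring.
      rewrite distrC; apply: Hf2 => //.
      - exact: le_trans (mx_entry_le _ _ _) (s0t _ ps).
      - exact: le_trans (mx_entry_le _ _ _) (s0t _ ps').
    move: l1 l2 l3; rewrite !ler_norml => l1 l2 /andP[l3 l3'].
    by apply/andP; split; lra.
  have pr2 : `|psi p - psi p0| < r by lra.
  have pr2' : `|psi p' - psi p0| < r by lra.
  have := lm_upper mod0 pr2 pr2'; rewrite Pp Pp' -/y => /le_lt_trans; apply.
  apply: (@le_lt_trans _ _ (Lam * (C3 * b))); first by rewrite ler_pM2l.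
  have -> : Lam * (C3 * b) = e / 2.
    by rewrite /b; field; rewrite !gt_eqF.
  lra.
have [s ss Hs] := cover_by_classes AF.
exists s; last by move=> p ps pt; exact: Hs.
apply: (@le_trans _ _ (#|{: 'I_d.+1 * {ffun 'I_d.+1 -> 'I_m1} * {ffun 'I_d -> 'I_m2}}|%:R)).
  by rewrite ler_nat.
rewrite !card_prod !card_ffun !card_ord !natrM.
rewrite [leRHS]mulrDl -[leLHS]addr0; apply: lerD; last first.
  by rewrite mul1r invr_ge0 exprn_ge0// ltW.
rewrite -[leRHS]mulrA; apply: ler_wpM2l; first by rewrite mulr_ge0.
by rewrite -expr_div_n natrX lerXn2r// nnegrE ?ler0n// divr_ge0// ltW.
Qed.

End LocalCover.

(** * Compact sets and word length *)

(** If Pi failed on K, the sets A such that Pi holds on K minus A would form a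
   proper filter, without cluster point in K. *)
Lemma compact_local_property (T : topologicalType) (Pi : set T -> Prop) :
  Pi set0 -> (forall A B, Pi A -> Pi B -> Pi (A `|` B)) ->
  (forall A B, A `<=` B -> Pi B -> Pi A) ->
  (forall p : T, exists2 U, nbhs p U & Pi U) ->
  forall K, compact K -> Pi K.
Proof.
move=> Pi0 PiU PiS Pil K cK; apply: contrapT => nK.
pose F : set_system T := [set A | Pi (K `\` A)].
have FF : ProperFilter F.
  split; first by rewrite /F /= setD0.
  split; first by rewrite /F /= setDT.
    by move=> A B FA FB; rewrite /F /= setDIr; exact: PiU.
  by move=> A B AB; apply: PiS => x [Kx nBx]; split => // /AB.
have FK : F K by rewrite /F /= setDv.
have [p [Kp clp]] := cK F FF FK.
have [U pU PU] := Pil p.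
have FU : F (~` U).
  by apply: PiS PU => x [_] /=; exact: contrapT.
by have [x [nU /nU]] := clp _ _ FU pU.
Qed.

Section CompactSets.
Context {R : realType} {d : nat} {M : metricType R}.
Hypothesis models : forall p0 : M, exists P psi Q (r rho lam Lam : R),
    local_model (d := d) p0 P psi Q r rho lam Lam.

(** Local compactness, seen through a local model. *)
Lemma ball_in_compact (p0 : M) : exists2 rho : R, 0 < rho &
  exists2 K, compact K & forall q, mdist p0 q < rho -> K q.
Proof.
have [P [psi [Q [r [rho [lam [Lam mod0]]]]]]] := models p0.
exists rho; first exact: lm_rho mod0.
have r0 := lm_r mod0; have Lam0 := lm_Lam mod0.
pose B := [set x : 'rV[R]_d | `|x - psi p0| <= r / 2].
exists (P @` B); last first.
  move=> q pq; have [qr Pq] := lm_coord mod0 pq.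
  by exists (psi q) => //; exact: ltW.
apply: continuous_compact; last first.
  apply: bounded_closed_compact.
    exists (`|psi p0| + r / 2); split; first exact: num_real.
    move=> x xr y yB; apply: le_trans (ltW xr).
    have -> : y = psi p0 + (y - psi p0) by rewrite addrC subrK.
    by apply: le_trans (ler_normD _ _) _; rewrite lerD2l.
  apply: (@closed_comp _ _ (fun x : 'rV[R]_d => `|x - psi p0|) [set t | t <= r / 2]).
    move=> x _; apply: (@cvg_norm _ _ _ (nbhs x)).
    by apply: cvgB; [exact: cvg_id|exact: cvg_cst].
  exact: closed_le.
apply: continuous_in_subspaceT => x /set_mem Bx.
have xr : `|x - psi p0| < r by apply: le_lt_trans Bx _; lra.
move=> U /nbhs_ballP[e /= e0 eU]; apply/nbhs_ballP.
exists (Num.min (r - `|x - psi p0|) (e / Lam)).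
  by rewrite /= lt_min subr_gt0 xr divr_gt0.
move=> y; rewrite -ball_normE /ball_ /= distrC lt_min => /andP[yx yxe].
have yr : `|y - psi p0| < r.
  have -> : y - psi p0 = (y - x) + (x - psi p0) by rewrite addrA subrK.
  by apply: le_lt_trans (ler_normD _ _) _; lra.
apply: eU; rewrite ballEmdist /=.
apply: le_lt_trans (lm_upper mod0 xr yr) _.
by rewrite mulrC -ltr_pdivlMr.
Qed.

Lemma compact_thickening (K : set M) : compact K ->
  exists2 rho : R, 0 < rho & exists2 K1, compact K1 &
    forall p q, K p -> mdist p q < rho -> K1 q.
Proof.
move=> cK; pose Pi (A : set M) := exists2 rho : R, 0 < rho &
  exists2 K1, compact K1 & forall p q, A p -> mdist p q < rho -> K1 q.
apply: (@compact_local_property _ Pi) cK.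
- exists 1 => //; exists set0 => //; exact: compact0.
- move=> A B [r1 r10 [K1 cK1 H1]] [r2 r20 [K2 cK2 H2]].
  exists (Num.min r1 r2); first by rewrite lt_min r10.
  exists (K1 `|` K2); first exact: compactU.
  move=> p q pAB; rewrite lt_min => /andP[q1 q2].
  by case: pAB => pA; [left; exact: H1 q1|right; exact: H2 q2].
- move=> A B AB [rr r0 [K1 cK1 H1]]; exists rr => //; exists K1 => // p q /AB.
  exact: H1.
- move=> p; have [rho rho0 [K1 cK1 H1]] := ball_in_compact p.
  have r2 : 0 < rho / 2 by rewrite divr_gt0.
  exists (ball p (rho / 2)); first exact: nbhsx_ballx.
  exists (rho / 2) => //; exists K1 => // q q'; rewrite ballEmdist /= => pq qq'.
  by apply: H1; apply: le_lt_trans (metric_triangle p q q') _; lra.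
Qed.

End CompactSets.

Section CompactCover.
Context {R : realType} {d : nat} {M : metricType R}.
Hypothesis models : forall p0 : M, exists P psi Q (r rho lam Lam : R),
    local_model (d := d.+1) p0 P psi Q r rho lam Lam.
Hypothesis walk : forall (p q : M) (s e : R), 0 <= s -> s <= mdist p q -> 0 < e ->
  exists2 z, mdist p z = s & mdist z q <= mdist p q - s + e.

(** The constant C depends neither on the centre o nor on the radius t; this is
   what makes it possible to use it for all the translates of K. *)
Lemma sphere_compact_cover (K : set M) : compact K ->
  exists2 C : R, 0 < C & forall e : R, 0 < e -> e <= 1 ->
    forall (o : M) (t : R), 1 <= t ->
    exists2 s : seq M, (size s)%:R <= C / e ^+ d &
      forall p, K p -> mdist o p = t -> exists2 c, c \in s & mdist c p < e.
Proof.
move=> cK; pose Pi (A : set M) := exists2 C : R, 0 < C & forall e : R, 0 < e -> e <= 1 ->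
    forall (o : M) (t : R), 1 <= t ->
    exists2 s : seq M, (size s)%:R <= C / e ^+ d &
      forall p, A p -> mdist o p = t -> exists2 c, c \in s & mdist c p < e.
apply: (@compact_local_property _ Pi) cK.
- exists 1 => // e e0 e1 o t t1; exists [::] => //=.
  by rewrite divr_ge0// exprn_ge0// ltW.
- move=> A B [C1 C10 H1] [C2 C20 H2]; exists (C1 + C2); first by rewrite addr_gt0.
  move=> e e0 e1 o t t1; have [s1 ss1 Hs1] := H1 e e0 e1 o t t1.
  have [s2 ss2 Hs2] := H2 e e0 e1 o t t1.
  exists (s1 ++ s2); first by rewrite size_cat natrD mulrDl lerD.
  move=> p [Ap|Bp] op.
    by have [c cs cp] := Hs1 p Ap op; exists c => //; rewrite mem_cat cs.
  by have [c cs cp] := Hs2 p Bp op; exists c => //; rewrite mem_cat cs orbT.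
- move=> A B AB [C C0 H]; exists C => // e e0 e1 o t t1.
  have [s ss Hs] := H e e0 e1 o t t1; exists s => // p /AB; exact: Hs.
- move=> p; have [P [psi [Q [r [rho [lam [Lam mod0]]]]]]] := models p.
  have [s0 [C [s00 C0 H]]] := sphere_local_cover walk mod0.
  exists (ball p s0); first exact: nbhsx_ballx.
  exists C => // e e0 e1 o t t1; have [s ss Hs] := H e e0 e1 o t t1.
  by exists s => // q; rewrite ballEmdist; exact: Hs.
Qed.

End CompactCover.

Section WordLength.
Context {G : groupType} (A : set G).
Hypothesis Afin : finite_set A.
Hypothesis Agen : generating_set A.
Implicit Types a b : G.

Lemma word_length_spec a : word_of_length A (word_length A a) a /\
  forall n, word_of_length A n a -> (word_length A a <= n)%N.
Proof.
rewrite /word_length; case: pselect => [ex|nex]; last first.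
  by case: nex; have [n Hn] := Agen a; exists n; apply/asboolP.
case: ex_minnP => n /asboolP Hn Hmin; split => // m Hm.
by apply: Hmin; apply/asboolP.
Qed.

Lemma word_lengthM a b :
  (word_length A (a * b)%g <= word_length A a + word_length A b)%N.
Proof.
have [[s [<- sA ->]] _] := word_length_spec a.
have [[t [<- tA ->]] _] := word_length_spec b.
have [_] := word_length_spec ((\prod_(c <- s) c) * (\prod_(c <- t) c))%g; apply.
exists (s ++ t); split; [by rewrite size_cat| |by rewrite big_cat].
by move=> c; rewrite mem_cat => /orP[/sA|/tA].
Qed.

Lemma word_ball_finite k : finite_set [set a | (word_length A a <= k)%N].
Proof.
have Bfin : finite_set (A `|` [set a | A (a^-1)%g]).
  rewrite finite_setU; split => //.
  apply: (@sub_finite_set _ _ ((fun a => (a^-1)%g) @` A)); last exact: finite_image.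
  by move=> a Aa; exists (a^-1)%g => //; rewrite invgK.
have Wfin n : finite_set [set a | word_of_length A n a].
  elim: n => [|n IH].
    apply: (@sub_finite_set _ _ [set 1%g]); last exact: finite_set1.
    by move=> a [s [/size0nil -> _ ->]]; rewrite big_nil.
  apply: (@sub_finite_set _ _ [set (a * b)%g | a in (A `|` [set a | A (a^-1)%g]) &
     b in [set a | word_of_length A n a]]); last exact: finite_image2.
  move=> a [[|b s] [//= [sn] sA ->]].
  exists b; first by apply: sA; rewrite mem_head.
  exists (\prod_(c <- s) c)%g; last by rewrite big_cons.
  by exists s; split => // c cs; apply: sA; rewrite in_cons cs orbT.
apply: (@sub_finite_set _ _ (\bigcup_(n in `I_k.+1) [set a | word_of_length A n a])).
  move=> a ak; exists (word_length A a) => //.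
  by have [] := word_length_spec a.
by apply: bigcup_finite => // n _; exact: Wfin.
Qed.

Lemma growth_enum k : exists2 s : seq G, size s = growth_function A k &
  forall a, (word_length A a <= k)%N -> a \in s.
Proof.
pose F := fset_set [set a | (word_length A a <= k)%N].
exists (finmap.enum_fset F) => // a ak.
have : a \in F by rewrite in_fset_set; [exact: mem_set|exact: word_ball_finite].
by [].
Qed.

Lemma finite_word_length_bound (S : set G) : finite_set S ->
  exists L, forall a, S a -> (word_length A a <= L)%N.
Proof.
move=> /finite_seqP[s ->]; exists (\max_(a <- s) word_length A a)%N => a /= sa.
exact: leq_bigmax_seq.
Qed.

End WordLength.

(** * Geometric actions and covers of large spheres *)

Section GeometricActions.
Context {R : realType} {d : nat} {M : metricType R} {G : groupType}.
Context {act : G -> M -> M}.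
Hypothesis hact : geometric_action act.
Hypothesis models : forall p0 : M, exists P psi Q (r rho lam Lam : R),
    local_model (d := d) p0 P psi Q r rho lam Lam.
Hypothesis walk : forall (p q : M) (s e : R), 0 <= s -> s <= mdist p q -> 0 < e ->
  exists2 z, mdist p z = s & mdist z q <= mdist p q - s + e.

Lemma actKV a (p : M) : act a (act (a^-1)%g p) = p.
Proof. by rewrite -(act_mul hact) mulgV (act_one hact). Qed.

(** Properness, applied to a compact set that contains a neighbourhood of K. *)
Lemma close_translates (K : set M) : compact K ->
  exists2 rho : R, 0 < rho & exists2 F : set G, finite_set F &
    forall a b p q, K p -> K q -> mdist (act a p) (act b q) < rho ->
      F (a^-1 * b)%g.
Proof.
move=> cK; have [rho rho0 [K1 cK1 H1]] := compact_thickening models cK.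
exists rho => //; exists [set a | (act a @` K1) `&` K1 !=set0].
  exact: (act_proper hact).
move=> a b p q Kp Kq ab.
exists (act (a^-1)%g (act b q)); split.
  exists q; first by apply: (H1 q) => //; rewrite mdistxx.
  by rewrite (act_mul hact).
by apply: (H1 p) => //; rewrite -(act_isometry hact a) actKV.
Qed.

(** The lower bound of the Milnor-Svarc lemma.  Walk from act a p to x0 by steps
   of length rho / 2, each of which brings one closer to x0 by at least rho / 4.
   Every point reached is in some translate of K, and the group elements of
   consecutive translates differ by a factor from a finite set F, whose word
   lengths are bounded by L. *)
Lemma orbit_word_length (K : set M) (A : set G) (x0 : M) : compact K ->
  \bigcup_(a in [set: G]) (act a @` K) = [set: M] ->
  finite_set A -> generating_set A ->
  exists2 c : R, 0 < c & forall (t : R), 1 <= t -> forall a p, K p ->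
    mdist (act a p) x0 <= t -> (word_length A a)%:R <= c * t.
Proof.
move=> cK Kcov Afin Agen.
have [rho rho0 [F Ffin HF]] := close_translates cK.
have [L HL] := finite_word_length_bound A Ffin.
have cov z : exists a k, K k /\ act a k = z.
  have : [set: M] z by []; rewrite -Kcov => -[a _ [k Kk akz]].
  by exists a, k.
have [a0 [k0 [Kk0 ak0]]] := cov x0.
have near_word a b p q : K p -> K q -> mdist (act a p) (act b q) < rho ->
    (word_length A b <= word_length A a + L)%N.
  move=> Kp Kq ab.
  have -> : b = (a * (a^-1 * b))%g by rewrite mulgA mulgV mul1g.
  apply: leq_trans (word_lengthM Agen _ _) _; rewrite leq_add2l.
  exact: HL (HF _ _ _ _ Kp Kq ab).
have ind n a p : K p -> mdist (act a p) x0 < n%:R * (rho / 4) + rho / 2 ->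
    (word_length A a <= word_length A a0 + n.+1 * L)%N.
  elim: n a p => [|n IH] a p Kp ap.
    rewrite mul1n; apply: (near_word a0 a k0 p) => //.
    by rewrite ak0 metric_sym; move: ap; rewrite mul0r; lra.
  have [small|big] := ltP (mdist (act a p) x0) (rho / 2).
    apply: (@leq_trans (word_length A a0 + L)).
      apply: (near_word a0 a k0 p) => //.
      by rewrite ak0 metric_sym; lra.
    by rewrite leq_add2l mulSn leq_addr.
  have r2 : 0 <= rho / 2 by lra.
  have r4 : 0 < rho / 4 by lra.
  have [z pz zx] := walk r2 big r4.
  have [b [k [Kk bk]]] := cov z.
  have ab : (word_length A a <= word_length A b + L)%N.
    apply: (near_word b a k p) => //; rewrite bk metric_sym pz; lra.
  apply: leq_trans ab _; rewrite [in leqRHS]mulSn addnCA addnC leq_add2l.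
  apply: (IH b k) => //; rewrite bk; apply: le_lt_trans zx _.
  by move: ap; rewrite -natr1 mulrDl mul1r; lra.
pose c : R := (word_length A a0)%:R + (4 / rho + 2) * L%:R + 1.
have q0 : 0 < 4 / rho by rewrite divr_gt0.
have c0 : 0 < c.
  by rewrite ltr_wpDl// addr_ge0// mulr_ge0// addr_ge0// ltW.
exists c => // t t1 a p Kp apt.
pose n := Num.truncn (4 / rho * t).
have X0 : 0 <= 4 / rho * t by rewrite mulr_ge0 ?(ltW q0)//; lra.
have /andP[n1 n2] := truncn_itv X0.
have tn : t < n.+1%:R * (rho / 4).
  rewrite -ltr_pdivrMr; last by lra.
  by rewrite invf_div mulrC.
have H : (word_length A a <= word_length A a0 + n.+2 * L)%N.
  by apply: (ind n.+1 a p) => //; lra.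
have {}H : (word_length A a)%:R <= (word_length A a0)%:R + n.+2%:R * L%:R :> R.
  by rewrite -natrM -natrD ler_nat.
apply: le_trans H _.
have w0 : (word_length A a0)%:R <= (word_length A a0)%:R * t :> R.
  by rewrite ler_peMr.
have L0 : n.+2%:R * L%:R <= (4 / rho * t + 2 * t) * L%:R.
  apply: ler_wpM2r => //; rewrite -2!natr1; move: n1; rewrite -/n; lra.
apply: le_trans (lerD w0 L0) _.
have -> : c * t = (word_length A a0)%:R * t + (4 / rho * t + 2 * t) * L%:R + t.
  by rewrite /c; ring.
by rewrite lerDl; lra.
Qed.

Lemma orbit_count (alpha : R) (K : set M) (x0 : M) : 0 < alpha ->
  polynomial_growth G alpha -> compact K ->
  \bigcup_(a in [set: G]) (act a @` K) = [set: M] ->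
  exists C R0 : R, [/\ 0 < C, 1 <= R0 & forall t : R, R0 <= t ->
    exists2 s : seq G, (size s)%:R <= C * t `^ alpha &
      forall a p, K p -> mdist (act a p) x0 <= t -> a \in s].
Proof.
move=> al0 [A [Afin Agen [C [k0 [C0 k00 Hg]]]]] cK Kcov.
have [c c0 Hc] := orbit_word_length x0 cK Kcov Afin Agen.
exists (C * (c + 1) `^ alpha), (Num.max 1 (k0 / c)); split.
- by rewrite mulr_gt0// powR_gt0//; lra.
- by rewrite le_max lexx.
move=> t; rewrite ge_max => /andP[t1 tk].
pose k := (Num.truncn (c * t)).+1.
have ct0 : 0 <= c * t by rewrite mulr_ge0 ?(ltW c0)//; lra.
have /andP[k1 k2] := truncn_itv ct0.
have kk0 : k0 <= k%:R.
  apply: ltW; apply: le_lt_trans k2; by rewrite mulrC -ler_pdivrMr.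
have [s ss Hs] := growth_enum Afin Agen k.
exists s; last first.
  move=> a p Kp ap; apply: Hs; rewrite -(ler_nat R).
  by apply: le_trans (Hc _ t1 _ _ Kp ap) _; exact: ltW.
rewrite ss; apply: le_trans (Hg _ kk0) _; rewrite -mulrA ler_pM2l//.
rewrite -powRM; [|lra|lra].
apply: ge0_ler_powR; rewrite ?nnegrE//; [exact: ltW|nra|].
by rewrite /k -natr1 mulrDl mul1r; lra.
Qed.

End GeometricActions.

Section SphereCover.
Context {R : realType} {d : nat} {M : metricType R} {G : groupType}.
Context {act : G -> M -> M}.
Hypothesis hact : geometric_action act.
Hypothesis models : forall p0 : M, exists P psi Q (r rho lam Lam : R),
    local_model (d := d.+1) p0 P psi Q r rho lam Lam.
Hypothesis walk : forall (p q : M) (s e : R), 0 <= s -> s <= mdist p q -> 0 < e ->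
  exists2 z, mdist p z = s & mdist z q <= mdist p q - s + e.

Lemma sphere_cover (alpha : R) (x0 : M) : 0 < alpha -> polynomial_growth G alpha ->
  exists C R0 : R, [/\ 0 < C, 1 <= R0 & forall t : R, R0 <= t ->
    forall e : R, 0 < e -> e <= 1 ->
    exists2 s : seq M, (size s)%:R <= C * t `^ alpha / e ^+ d &
      forall p, mdist x0 p = t -> exists2 c, c \in s & mdist c p < e].
Proof.
move=> al0 hgrowth; have [K cK Kcov] := act_cocompact hact.
have [C1 [R0 [C10 R01 H1]]] := orbit_count hact models walk x0 al0 hgrowth cK Kcov.
have [C2 C20 H2] := sphere_compact_cover models walk cK.
exists (C1 * C2), R0; split => //; first by rewrite mulr_gt0.
move=> t tR e e0 e1; have [s ss Hs] := H1 t tR.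
have t1 : 1 <= t by lra.
(* pull the part of the sphere in the translate aK back to K *)
have /choice[f Hf] : forall a : G, exists u : seq M,
    (size u)%:R <= C2 / e ^+ d /\
    forall p, K p -> mdist (act (a^-1)%g x0) p = t ->
      exists2 c, c \in u & mdist c p < e.
  by move=> a; have [u su Hu] := H2 e e0 e1 (act (a^-1)%g x0) t t1; exists u.
exists (flatten [seq map (act a) (f a) | a <- s]).
  apply: (@le_trans _ _ ((size s)%:R * (C2 / e ^+ d))).
    elim: s {ss Hs} => [|a s IH] /=; first by rewrite mul0r.
    rewrite size_cat size_map natrD -natr1 mulrDl mul1r addrC.
    by apply: lerD => //; have [] := Hf a.
  have -> : C1 * C2 * t `^ alpha / e ^+ d = (C1 * t `^ alpha) * (C2 / e ^+ d) by ring.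
  by apply: ler_wpM2r => //; rewrite divr_ge0 ?exprn_ge0// ltW.
move=> p pt; have : [set: M] p by [].
rewrite -Kcov => -[a _ [k Kk akp]].
have xk : mdist (act (a^-1)%g x0) k = t.
  by rewrite -(act_isometry hact a) (actKV hact) akp.
have [_ /(_ k Kk xk)[c cf ck]] := Hf a.
exists (act a c); last by rewrite -akp (act_isometry hact).
apply/flattenP; exists (map (act a) (f a)); last exact: map_f.
by apply: map_f; apply: (Hs a k) => //; rewrite akp metric_sym pt.
Qed.

Lemma mdist_boundary (x0 p : M) (t : R) : boundary (ball x0 t) p -> mdist x0 p = t.
Proof.
move=> [cl nint]; apply/eqP; rewrite eq_le; apply/andP; split.
  apply/ler_addgt0Pr => e e0.
  have [q [xq pq]] := cl _ (nbhsx_ballx p e e0).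
  move: xq pq; rewrite !ballEmdist /= => xq pq.
  have := metric_triangle x0 q p; rewrite (metric_sym q p); lra.
rewrite leNgt; apply/negP => pt; apply: nint.
apply/nbhs_ballP; exists (t - mdist x0 p); first by rewrite /= subr_gt0.
move=> q; rewrite !ballEmdist /= => pq.
by have := metric_triangle x0 p q; lra.
Qed.

Lemma covering_radius_le (N : nat) (A : set M) (e : R) (s : seq M) (x0 : M) :
  0 < e -> (size s <= N)%N ->
  (forall p, A p -> exists2 c, c \in s & mdist c p < e) ->
  0 <= covering_radius N A <= e.
Proof.
move=> e0 sN As.
have mem : [set r : R | 0 < r /\
    exists x : 'I_N -> M, A `<=` \bigcup_(i in [set: 'I_N]) ball (x i) r] e.
  split => //; exists (fun i : 'I_N => nth x0 s i) => p /As[c cs cp].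
  have iN : (index c s < N)%N by apply: leq_trans sN; rewrite index_mem.
  by exists (Ordinal iN) => //; rewrite /= nth_index// ballEmdist.
apply/andP; split.
  by apply: lb_le_inf; [exists e|move=> r [/ltW]].
by apply: ge_inf => //; exists 0 => r [/ltW].
Qed.

(** If N is larger than T = O(t ^ alpha), a number of balls of radius 1 that is
   enough to cover the sphere, then e is chosen so that at most N balls of
   radius e cover it; otherwise one ball of radius 2 t suffices. *)
Lemma sphere_covering_radius (alpha : R) (x0 : M) : (0 < d)%N ->
  0 < alpha -> polynomial_growth G alpha ->
  exists C R0 : R, [/\ 0 < C, 1 <= R0 & forall (t : R) (N : nat), R0 <= t ->
    (1 <= N)%N -> 0 <= covering_radius N (boundary (ball x0 t)) /\
      N%:R * covering_radius N (boundary (ball x0 t)) ^+ d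
        <= C * t `^ (alpha + d%:R)].
Proof.
move=> d0 al0 hgrowth.
have [C [R0 [C0 R01 H]]] := sphere_cover x0 al0 hgrowth.
exists (C * 2 ^+ d), R0; split => //; first by rewrite mulr_gt0// exprn_gt0.
move=> t N tR N1; have t1 : 1 <= t by lra.
have t0 : 0 < t by lra.
set r := covering_radius _ _.
have N0 : 0 < N%:R :> R by rewrite ltr0n.
have talpha : 0 < t `^ alpha by rewrite powR_gt0.
pose T := C * t `^ alpha.
have T0 : 0 < T by rewrite mulr_gt0.
have TE : C * 2 ^+ d * t `^ (alpha + d%:R) = T * (2 * t) ^+ d.
  have -> : t `^ (alpha + d%:R) = t `^ alpha * t ^+ d.
    rewrite powRD; last by rewrite (gt_eqF t0) implybT.
    by rewrite powR_mulrn// ltW.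
  by rewrite exprMn /T; ring.
have /andP[r0 rt] : 0 <= r <= 2 * t.
  apply: (@covering_radius_le _ _ _ [:: x0] x0) => //; first lra.
  move=> p /mdist_boundary pt; exists x0; first by rewrite mem_head.
  by rewrite pt; lra.
split=> //; rewrite TE.
have [TN|/ltW NT] := leP T N%:R; last first.
  by apply: ler_pM => //; [exact: exprn_ge0|rewrite lerXn2r// nnegrE; lra].
pose e := (T / N%:R) `^ (d%:R^-1).
have TN0 : 0 < T / N%:R by rewrite divr_gt0.
have e0 : 0 < e by rewrite powR_gt0.
have ed : e ^+ d = T / N%:R.
  rewrite -powR_mulrn ?(ltW e0)// /e -powRrM mulVf ?pnatr_eq0 -?lt0n//.
  by rewrite powRr1// ltW.
have e1 : e <= 1.
  rewrite -(@ler_pXn2r _ d)// ?nnegrE ?(ltW e0)// ed expr1n.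
  by rewrite ler_pdivrMr// mul1r.
have [s ss Hs] := H t tR e e0 e1.
have /andP[_ re] : 0 <= r <= e.
  apply: (@covering_radius_le _ _ _ s x0) => //.
    rewrite -(ler_nat R); apply: le_trans ss _; rewrite ed -/T.
    by rewrite invf_div mulrC divfK// gt_eqF.
  by move=> p /mdist_boundary; exact: Hs.
apply: (@le_trans _ _ T).
  apply: (@le_trans _ _ (N%:R * e ^+ d)).
    by rewrite ler_pM2l// lerXn2r// nnegrE ltW.
  by rewrite ed mulrC divfK// gt_eqF.
rewrite ler_peMr ?(ltW T0)// exprn_ege1//; lra.
Qed.

End SphereCover.

Theorem proposition1p8 (R : realType) (d : nat) (M : metricType R)
    (S : smooth_manifold R d M) (g : riemannian_metric S)
    (G : groupType) (act : G -> M -> M) (alpha : R)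
    (hd : (2 <= d)%N)
    (hdist : forall x y : M, mdist x y = riemannian_dist g x y)
    (hcomplete : complete_space M)
    (hconnected : connected [set: M])
    (hact : geometric_action act)
    (halpha : 0 < alpha)
    (hgrowth : polynomial_growth G alpha) :
  (forall x0 : M, exists C R0 : R, [/\ 0 < C, 0 < R0 &
    forall (r : R) (N : nat), R0 <= r -> (1 <= N)%N ->
      N%:R * covering_radius N (boundary (ball x0 r)) ^+ (d - 1)%N
        <= C * r `^ (alpha + d%:R - 1)])
  /\
  (forall x0 : M, exists C' R0 : R, [/\ 0 < C', 0 < R0 &
    forall (r : R) (k : nat), R0 <= r -> (1 <= k)%N ->
      k%:R * covering_radius (k ^ (d - 1))%N (boundary (ball x0 r))
        <= C' * r `^ (alpha / (d%:R - 1) + 1)]).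
Proof.
have walk := walk_towards hdist; have models := exists_local_model hdist.
case: d hd S g hdist walk models => [//|d] hd S g hdist walk models.
have d0 : (0 < d)%N by [].
have main x0 := sphere_covering_radius hact models walk x0 d0 halpha hgrowth.
have dE : d.+1%:R - 1 = d%:R :> R by rewrite -natr1 addrK.
have dn0 : d%:R != 0 :> R by rewrite pnatr_eq0 -lt0n.
rewrite subn1 /= -addrA dE; split=> x0; have [C [R0 [C0 R01 H]]] := main x0.
  exists C, R0; split => //; first lra.
  by move=> r N rR N1; have [] := H r N rR N1.
exists (C `^ d%:R^-1), R0; split; [by rewrite powR_gt0|lra|].
move=> r k rR k1; have r0 : 0 < r by lra.
have kd : (1 <= k ^ d)%N by rewrite expn_gt0 k1.
have [rad0 +] := H r (k ^ d)%N rR kd; set rad := covering_radius _ _.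
rewrite natrX -exprMn => Hk.
have pos : 0 <= C `^ d%:R^-1 * r `^ (alpha / d%:R + 1).
  by rewrite mulr_ge0// powR_ge0.
rewrite -(@ler_pXn2r _ d)// ?nnegrE ?mulr_ge0//.
apply: le_trans Hk _.
rewrite exprMn -!powR_mulrn ?powR_ge0// -!powRrM mulVf// powRr1 ?(ltW C0)//.
by rewrite mulrDl mul1r divfK.
Qed.
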